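(* Let $G$ be a connected Lie group of dimension $n$ with Lie algebra $\mathfrak{g}$ and let $\{\mathcal{X},Y_1,\dots,Y_{n-1}\}$ define a simple almost-Riemannian structure on $G$, where $\mathcal{X}$ is a linear vector field with flow $(\varphi_t)_{t\in\mathbb{R}}$. Let $\widetilde{G}=G\rtimes_{\varphi}\mathbb{R}$ be the semi-direct product with law $(g_1,\tau_1)\cdot(g_2,\tau_2)=(\varphi_{\tau_2}(g_1)g_2,\tau_1+\tau_2)$, with Lie algebra $\widetilde{\mathfrak{g}}$, and let $\widetilde{\mathcal{X}}$ be the left-invariant vector field on $\widetilde{G}$ equal to $\frac{\partial}{\partial\tau}$ at the identity. Then: (1) $\widetilde{\mathcal{X}}=\mathcal{X}+\frac{\partial}{\partial\tau}$, and $\widetilde{\Delta}=\mathrm{Span}\{\widetilde{\mathcal{X}},Y_1,\dots,Y_{n-1}\}$ is a left-invariant distribution of codimension $1$ on $\widetilde{G}$ satisfying the rank condition, $\mathcal{LA}\{\widetilde{\mathcal{X}},Y_1,\dots,Y_{n-1}\}=\mathbb{R}\widetilde{\mathcal{X}}\oplus\mathfrak{g}=\widetilde{\mathfrak{g}}$; hence declaring $\widetilde{\mathcal{X}},Y_1,\dots,Y_{n-1}$ orthonormal defines a corank one left-invariant sub-Riemannian structure on $\widetilde{G}$. (2) Under the identification of the space $\widetilde{G}/\mathbb{R}$ of right cosets of $\mathbb{R}=\{e\}\times\mathbb{R}$ with $G$, the projections of $\widetilde{\mathcal{X}},Y_1,\dots,Y_{n-1}$ onto $\widetilde{G}/\mathbb{R}$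 are $\mathcal{X},Y_1,\dots,Y_{n-1}$ respectively. (3) Let $g_0,g_1\in G$ and let $\bar u=(\bar v,\bar u_1,\dots,\bar u_{n-1})$ be a minimal control steering $g_0$ to $g_1$ on $[0,T]$ for the almost-Riemannian structure on $G$. Then, on $\widetilde{G}$, the control $\bar u$ steers $(g_0,\tau_0)$ to $(g_1,\tau_1)$ for any $\tau_0,\tau_1$ with $\tau_1-\tau_0=\int_0^T\bar v(t)\,dt$, and it is minimal for the sub-Riemannian structure.
   Context: The Lie algebra $\mathfrak{g}$ is the set of left-invariant vector fields on $G$. A vector field $\mathcal{X}$ on $G$ is linear if its flow is a one-parameter group of automorphisms of $G$; then $[\mathcal{X},Y]\in\mathfrak{g}$ for all $Y\in\mathfrak{g}$. A simple almost-Riemannian structure (ARS) on $G$ is defined by $n=\dim G$ vector fields $\{\mathcal{X},Y_1,\dots,Y_{n-1}\}$ (declared orthonormal) such that $\mathcal{X}$ is linear, $Y_1,\dots,Y_{n-1}$ are left-invariant, the rank of $\mathcal{X},Y_1,\dots,Y_{n-1}$ is $n$ on a nonempty subset of $G$, and the rank condition holds: at every point the Lie algebra $\mathcal{LA}\{\mathcal{X},Y_1,\dots,Y_{n-1}\}$ of vector fields generated by these fields spans the tangent space. $G$ is identified with the normal subgroup $G\times\{0\}$ of $\widetilde{G}$, and $Y\in\mathfrak{g}$ with the left-invariant vector field $(Y,0)$ of $\widetilde{G}$. The right coset of $(g,\tau)$ is $(\{e\}\times\mathbb{R})(g,\tau)=\{g\}\times\mathbb{R}$, which is identified with $g\in G$.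 The ARS dynamics is $\dot g=v\mathcal{X}+\sum_{i=1}^{n-1}u_iY_i$; the sub-Riemannian dynamics is $\dot g=v\mathcal{X}+\sum_{i=1}^{n-1}u_iY_i$, $\dot\tau=v$. On $G$ the almost-Riemannian norm of a vector $w\in\mathrm{Span}\{\mathcal{X}_g,Y_1(g),\dots,Y_{n-1}(g)\}$ is $\|w\|=\min\{(v^2+\sum u_i^2)^{1/2}:\ v\mathcal{X}_g+\sum u_iY_i(g)=w\}$, and the length of an admissible curve $\gamma$ is $\int_0^T\|\dot\gamma(t)\|\,dt$. A minimal control $\bar u$ steering $g_0$ to $g_1$ is a control whose associated curve $\gamma$ minimizes the length among admissible curves from $g_0$ to $g_1$ and such that $\|\bar u(t)\|=(\bar v^2(t)+\sum_i\bar u_i^2(t))^{1/2}=\|\dot\gamma(t)\|$ for a.e. $t\in[0,T]$. On $\widetilde{G}$ the length of the trajectory of a control $\tilde u$ is $\int_0^T\|\tilde u(t)\|\,dt$, and a control is minimal if its trajectory minimizes the length between its endpoints. *)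

(* Defs.v *)
From HB Require Import structures.
From mathcomp Require Import all_boot all_order all_algebra.
From mathcomp Require Import all_classical all_reals all_analysis.
Set Implicit Arguments.
Unset Strict Implicit.
Unset Printing Implicit Defensive.
Import Order.TTheory GRing.Theory Num.Theory.
Import numFieldNormedType.Exports.
Local Open Scope classical_set_scope.
Local Open Scope ring_scope.

(** * Smooth manifolds modelled on a normed space [E]

    [E] is only ever instantiated with finite-dimensional spaces: ['rV_n], [R],
    and products of these. *)

Section Manifolds.
Context {R : realType}.

(* [C^k] on an open set [U]. Asking that [x |-> 'd f x v] be [C^k] for every
   [v] amounts, in finite dimension, to asking that [x |-> 'd f x] be [C^k]. *)
Fixpoint Ck {E F : normedModType R} (k : nat) (U : set E) (f : E -> F) : Prop :=
  match k with
  | 0 => forall x, U x -> {for x, continuous f}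
  | k'.+1 => (forall x, U x -> differentiable f x) /\
             (forall v : E, Ck k' U (fun x => 'd f x v))
  end.

Definition smooth_on {E F : normedModType R} (U : set E) (f : E -> F) :=
  forall k, Ck k U f.

(* Both maps are total; they are meaningful on [chart_dom] and on its image. *)
Record chart (M : topologicalType) (E : normedModType R) := Chart {
  chart_dom : set M;
  chart_fun : M -> E;
  chart_inv : E -> M }.

Definition is_chart {M : topologicalType} {E : normedModType R}
    (c : chart M E) :=
  [/\ open (chart_dom c),
      open (chart_fun c @` chart_dom c),
      forall p, chart_dom c p -> chart_inv c (chart_fun c p) = p,
      forall p, chart_dom c p -> {for p, continuous (chart_fun c)} &
      forall p, chart_dom c p -> {for chart_fun c p, continuous (chart_inv c)}].

Record smooth_space (E : normedModType R) := SmoothSpace {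
  carrier :> topologicalType;
  atlas : set (chart carrier E) }.
Arguments atlas {E} s.

Definition manifold {E : normedModType R} (M : smooth_space E) :=
  [/\ hausdorff_space M,
      @second_countable M,
      forall c, atlas M c -> is_chart c,
      forall p : M, exists2 c, atlas M c & chart_dom c p &
      forall c d, atlas M c -> atlas M d ->
        smooth_on (chart_fun c @` (chart_dom c `&` chart_dom d))
                  (chart_fun d \o chart_inv c)].

Definition real_space : smooth_space R^o :=
  @SmoothSpace R^o R [set Chart setT (fun x : R => x : R^o) (fun x : R^o => x : R)].

Definition prod_chart {E F : normedModType R} {M N : topologicalType}
    (c : chart M E) (d : chart N F) : chart (M * N)%type (E * F)%type :=
  Chart (chart_dom c `*` chart_dom d)
        (fun p => (chart_fun c p.1, chart_fun d p.2))
        (fun x => (chart_inv c x.1, chart_inv d x.2)).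

Definition prod_space {E F : normedModType R}
    (M : smooth_space E) (N : smooth_space F) : smooth_space (E * F)%type :=
  @SmoothSpace (E * F)%type (M * N)%type
    [set e | exists c d, [/\ atlas M c, atlas N d & e = prod_chart c d]].

Definition smooth_map {E F : normedModType R}
    (M : smooth_space E) (N : smooth_space F) (f : M -> N) :=
  continuous f /\
  forall c d, atlas M c -> atlas N d ->
    smooth_on (chart_fun c @` (chart_dom c `&` f @^-1` chart_dom d))
              (chart_fun d \o f \o chart_inv c).

Definition smooth_fun {E : normedModType R} (M : smooth_space E) (f : M -> R) :=
  smooth_map (N := real_space) f.

(** * Tangent vectors and vector fields *)

(* A tangent vector is the derivation it induces on [C^oo(M)], and a vector
   field the operator it induces on [C^oo(M)]. Both are extended by 0 to
   non-smooth functions, so that equality is Leibniz equality. *)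
Definition functional {E : normedModType R} (M : smooth_space E) :=
  (M -> R) -> R.
Definition operator {E : normedModType R} (M : smooth_space E) :=
  (M -> R) -> (M -> R).

Definition on_smooth {E : normedModType R} (M : smooth_space E)
    (D : (M -> R) -> R) : functional M :=
  fun f => if `[< smooth_fun f >] then D f else 0.

(* the vector of coordinates [v] at [p] in the chart [c] *)
Definition chart_vector {E : normedModType R} (M : smooth_space E)
    (c : chart M E) (p : M) (v : E) : functional M :=
  on_smooth (fun f => 'd (f \o chart_inv c : E -> R^o) (chart_fun c p) v).

Definition tangent {E : normedModType R} (M : smooth_space E) (p : M) :
    set (functional M) :=
  [set D | exists c v,
    [/\ atlas M c, chart_dom c p & D = chart_vector c p v]].

Definition at_point {E : normedModType R} (M : smooth_space E)
    (X : operator M) (p : M) : functional M :=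
  fun f => X f p.

Definition vector_field {E : normedModType R} (M : smooth_space E)
    (X : operator M) :=
  (forall p, tangent p (at_point X p)) /\
  (forall f, smooth_fun f -> smooth_fun (X f)).

(* [dmap phi] is the tangent map of [phi : M -> N]. *)
Definition dmap {E F : normedModType R}
    (M : smooth_space E) (N : smooth_space F) (phi : M -> N)
    (D : functional M) : functional N :=
  on_smooth (fun h => D (h \o phi)).

Definition velocity {E : normedModType R} (M : smooth_space E)
    (gamma : R -> M) (t : R) : functional M :=
  on_smooth (fun f => derive1 (f \o gamma : R -> R^o) t).

Definition fcomb {E : normedModType R} (M : smooth_space E) (k : nat)
    (a : 'I_k -> R) (D : 'I_k -> functional M) : functional M :=
  fun f => \sum_(i < k) a i * D i f.

Definition op_lin {E : normedModType R} (M : smooth_space E)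
    (a : R) (X Y : operator M) : operator M :=
  fun f p => a * X f p + Y f p.

Definition op_zero {E : normedModType R} (M : smooth_space E) : operator M :=
  fun _ _ => 0.

Definition bracket {E : normedModType R} (M : smooth_space E)
    (X Y : operator M) : operator M :=
  fun f p => X (Y f) p - Y (X f) p.

Definition lie_subalgebra {E : normedModType R} (M : smooth_space E)
    (L : set (operator M)) :=
  [/\ L (op_zero (M := M)),
      forall a X Y, L X -> L Y -> L (op_lin a X Y) &
      forall X Y, L X -> L Y -> L (bracket X Y)].

Definition LA {E : normedModType R} (M : smooth_space E)
    (S : set (operator M)) : set (operator M) :=
  [set Z | forall L, lie_subalgebra L -> S `<=` L -> L Z].

Definition rank_condition {E : normedModType R} (M : smooth_space E)
    (S : set (operator M)) :=
  forall p, [set at_point Z p | Z in LA S] = tangent p.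

(** * Systems of vector fields *)

Definition independent_at {E : normedModType R} (M : smooth_space E) (k : nat)
    (F : 'I_k -> operator M) (p : M) :=
  forall a : 'I_k -> R,
    (forall f, fcomb a (fun i => at_point (F i) p) f = 0) -> forall i, a i = 0.

Definition span_at {E : normedModType R} (M : smooth_space E) (k : nat)
    (F : 'I_k -> operator M) (p : M) : set (functional M) :=
  [set D | exists a : 'I_k -> R, D = fcomb a (fun i => at_point (F i) p)].

(* The span has codimension 1 in the tangent space, i.e., the line of some
   [W] is a complement of it. *)
Definition codim1_at {E : normedModType R} (M : smooth_space E) (k : nat)
    (F : 'I_k -> operator M) (p : M) :=
  span_at F p `<=` tangent p /\
  exists W, [/\ tangent p W, ~ span_at F p W &
    forall D, tangent p D ->
      exists a : R, span_at F p (fun f => D f - a * W f)].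

(* The fields [F i] are an orthonormal frame of a sub-Riemannian structure of
   (constant) rank [k]. *)
Definition subriemannian {E : normedModType R} (M : smooth_space E) (k : nat)
    (F : 'I_k -> operator M) :=
  [/\ forall i, vector_field (F i),
      forall p, independent_at F p &
      rank_condition (range F)].

Definition frame {E : normedModType R} (M : smooth_space E) (m : nat)
    (X : operator M) (Y : 'I_m -> operator M) : 'I_m.+1 -> operator M :=
  fun i => if unlift ord0 i is Some j then Y j else X.

(** * Lie groups *)

Record lie_data (E : normedModType R) := LieData {
  lie_space :> smooth_space E;
  lmul : lie_space -> lie_space -> lie_space;
  lone : lie_space;
  linv : lie_space -> lie_space }.

Definition lie_group {E : normedModType R} (G : lie_data E) :=
  [/\ manifold G,
      [/\ associative (@lmul _ G), left_id (lone G) (@lmul _ G),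
          right_id (lone G) (@lmul _ G),
          left_inverse (lone G) (@linv _ G) (@lmul _ G) &
          right_inverse (lone G) (@linv _ G) (@lmul _ G)],
      smooth_map (M := prod_space G G) (N := G) (fun p => lmul p.1 p.2) &
      smooth_map (M := G) (N := G) (@linv _ G)].

Definition left_invariant {E : normedModType R} (G : lie_data E)
    (X : operator G) :=
  forall g h : G, dmap (N := G) (lmul g) (at_point X h) = at_point X (lmul g h).

Definition lie_algebra {E : normedModType R} (G : lie_data E) :
    set (operator G) :=
  [set X | vector_field X /\ left_invariant X].

(* the left-invariant vector field equal to [D] at the identity *)
Definition left_field {E : normedModType R} (G : lie_data E)
    (D : functional G) : operator G :=
  fun f g => dmap (N := G) (lmul g) D f.

Definition left_invariant_distribution {E : normedModType R} (G : lie_data E)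
    (k : nat) (F : 'I_k -> operator G) :=
  forall g h : G,
    dmap (N := G) (lmul g) @` span_at F h = span_at F (lmul g h).

(* [phi] is the flow of [X], and is a one-parameter group of automorphisms.
   As the flow of a smooth vector field, [phi] is smooth in [(t, g)]. *)
Definition linear_flow {E : normedModType R} (G : lie_data E)
    (X : operator G) (phi : R -> G -> G) :=
  [/\ smooth_map (M := prod_space real_space G) (N := G)
        (fun p => phi p.1 p.2),
      forall t g, velocity (phi^~ g) t = at_point X (phi t g),
      (forall g, phi 0 g = g) /\
      (forall s t g, phi (s + t) g = phi s (phi t g)) &
      forall t g h, phi t (lmul g h) = lmul (phi t g) (phi t h)].

Definition simple_ARS {n : nat} (G : lie_data 'rV[R]_n.+1)
    (X : operator G) (Y : 'I_n -> operator G) (phi : R -> G -> G) :=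
  [/\ vector_field X /\ linear_flow X phi,
      forall i, lie_algebra (Y i),
      exists g, independent_at (frame X Y) g &
      rank_condition (range (frame X Y))].

(** * Control systems *)

(* Absolute continuity on [[a, b]]; [I] is a finite family of non-overlapping
   subintervals, given by their endpoints. *)
Definition abs_cont {E : normedModType R} (a b : R) (f : R -> E) :=
  forall e : R, 0 < e -> exists2 d : R, 0 < d &
    forall (k : nat) (I : 'I_k -> R * R),
      (forall i, [&& a <= (I i).1, (I i).1 <= (I i).2 & (I i).2 <= b]) ->
      (forall i j, i != j -> ((I i).2 <= (I j).1) || ((I j).2 <= (I i).1)) ->
      \sum_(i < k) ((I i).2 - (I i).1) < d ->
      \sum_(i < k) `|f (I i).2 - f (I i).1| < e.

Definition abs_cont_curve {E : normedModType R} (M : smooth_space E)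
    (T : R) (gamma : R -> M) :=
  {within `[0, T], continuous gamma} /\
  forall c (a b : R), atlas M c -> 0 <= a -> a <= b -> b <= T ->
    gamma @` `[a, b] `<=` chart_dom c ->
    abs_cont a b (chart_fun c \o gamma).

Definition curve_derivable {E : normedModType R} (M : smooth_space E)
    (gamma : R -> M) (t : R) :=
  exists c, [/\ atlas M c, chart_dom c (gamma t) &
                derivable (chart_fun c \o gamma : R^o -> E) t 1].

(* [gamma] is a solution on [[0, T]] of the system
   [gamma' = \sum_i u_i F_i(gamma)], for the integrable control [u]. *)
Definition trajectory {E : normedModType R} (M : smooth_space E) (k : nat)
    (F : 'I_k -> operator M) (T : R) (u : R -> 'I_k -> R) (gamma : R -> M) :=
  [/\ forall i, (@lebesgue_measure R).-integrable `[0, T]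
        (fun t => (u t i)%:E),
      abs_cont_curve T gamma &
      {ae @lebesgue_measure R, forall t, `[0, T]%classic t ->
        curve_derivable gamma t /\
        velocity gamma t = fcomb (u t) (fun i => at_point (F i) (gamma t))}].

Definition steers {E : normedModType R} (M : smooth_space E) (k : nat)
    (F : 'I_k -> operator M) (T : R) (u : R -> 'I_k -> R) (gamma : R -> M)
    (p q : M) :=
  [/\ 0 <= T, trajectory F T u gamma, gamma 0 = p & gamma T = q].

Definition enorm {k : nat} (a : 'I_k -> R) : R :=
  Num.sqrt (\sum_(i < k) a i ^+ 2).

(* The almost-Riemannian norm. The infimum is attained as soon as [w] is in
   the span of the fields at [p]. *)
Definition ARnorm {E : normedModType R} (M : smooth_space E) (k : nat)
    (F : 'I_k -> operator M) (p : M) (w : functional M) : R :=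
  inf [set enorm a | a in
        [set a : 'I_k -> R | fcomb a (fun i => at_point (F i) p) = w]].

Definition ARlength {E : normedModType R} (M : smooth_space E) (k : nat)
    (F : 'I_k -> operator M) (T : R) (gamma : R -> M) : \bar R :=
  (\int[@lebesgue_measure R]_(t in `[0%R, T])
     (ARnorm F (gamma t) (velocity gamma t))%:E)%E.

Definition AR_minimal {E : normedModType R} (M : smooth_space E) (k : nat)
    (F : 'I_k -> operator M) (T : R) (u : R -> 'I_k -> R) (p q : M) :=
  exists gamma : R -> M,
    [/\ steers F T u gamma p q,
        forall T' u' gamma', steers F T' u' gamma' p q ->
          (ARlength F T gamma <= ARlength F T' gamma')%E &
        {ae @lebesgue_measure R, forall t, `[0, T]%classic t ->
          enorm (u t) = ARnorm F (gamma t) (velocity gamma t)}].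

Definition SRlength {k : nat} (T : R) (u : R -> 'I_k -> R) : \bar R :=
  (\int[@lebesgue_measure R]_(t in `[0%R, T]) (enorm (u t))%:E)%E.

Definition SR_minimal {E : normedModType R} (M : smooth_space E) (k : nat)
    (F : 'I_k -> operator M) (T : R) (u : R -> 'I_k -> R) (p q : M) :=
  (exists gamma, steers F T u gamma p q) /\
  forall T' u' gamma', steers F T' u' gamma' p q ->
    (SRlength T u <= SRlength T' u')%E.

(** * The semi-direct product *)

Definition semidirect {E : normedModType R} (G : lie_data E)
    (phi : R -> G -> G) : lie_data (E * R^o)%type :=
  @LieData (E * R^o)%type (prod_space G real_space)
    (fun p q => (lmul (phi q.2 p.1) q.1, p.2 + q.2))
    (lone G, 0)
    (fun p => (phi (- p.2) (linv p.1), - p.2)).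

Definition dtau {E : normedModType R} (G : lie_data E) (phi : R -> G -> G) :
    operator (semidirect phi) :=
  fun f p => velocity (M := semidirect phi) (fun s => (p.1, s)) p.2 f.

(* a vector field [X] on [G], seen as the field [(X, 0)] on the product *)
Definition lift_field {E : normedModType R} (G : lie_data E) (phi : R -> G -> G)
    (X : operator G) : operator (semidirect phi) :=
  fun f p =>
    dmap (N := semidirect phi) (fun g => (g, p.2)) (at_point X p.1) f.

Definition Xtilde {E : normedModType R} (G : lie_data E) (phi : R -> G -> G) :
    operator (semidirect phi) :=
  left_field (G := semidirect phi)
    (at_point (dtau (phi := phi)) (lone (semidirect phi))).

Definition frame_tilde {E : normedModType R} (G : lie_data E)
    (phi : R -> G -> G) (m : nat) (Y : 'I_m -> operator G) :
    'I_m.+1 -> operator (semidirect phi) :=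
  frame (Xtilde (phi := phi)) (fun i => lift_field (phi := phi) (Y i)).

(* the right coset of [p] modulo [{e} x R] *)
Definition right_coset {E : normedModType R} (G : lie_data E)
    (phi : R -> G -> G) (p : semidirect phi) : set (semidirect phi) :=
  [set lmul ((lone G, s) : semidirect phi) p | s in [set: R]].

Definition projects_to {E : normedModType R} (G : lie_data E)
    (phi : R -> G -> G) (Z : operator (semidirect phi)) (X : operator G) :=
  forall p : semidirect phi,
    dmap (M := semidirect phi) (N := G) fst (at_point Z p) = at_point X p.1.

End Manifolds.

Arguments atlas {R E} s.
Arguments op_zero {R E} M.
Arguments dtau {R E G} phi.
Arguments lift_field {R E G} phi X.
Arguments Xtilde {R E G} phi.
Arguments frame_tilde {R E G} phi {m} Y.

(* Main.v *)
Require Import Defs.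
From HB Require Import structures.
From mathcomp Require Import all_boot all_order all_algebra.
From mathcomp Require Import all_classical all_reals all_analysis.
From mathcomp Require Import measurable_realfun ring.
Set Implicit Arguments.
Unset Strict Implicit.
Unset Printing Implicit Defensive.
Import Order.TTheory GRing.Theory Num.Theory.
Import numFieldNormedType.Exports.
Local Open Scope classical_set_scope.
Local Open Scope ring_scope.

(** The law of the semi-direct product gives
    [(g, t) * (e, s) = (phi s g, t + s)], so that the left-invariant field
    with value [dtau] at the identity is the sum of the linear field and of
    [dtau] ([Xtilde_decomp]). Forgetting [tau] therefore sends it to the linear
    field and sends the lift of a left-invariant field to that field.

    Rank condition. The left-invariant fields of the semi-direct product are
    the combinations [a Xtilde + Z] with [Z] left-invariant on [G]
    ([lie_algebra_semidirect]), because a left-invariant field is determined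
    by its value at one point. Brackets are transported by lifting:
    [[Xtilde, Z]] is the lift of [[X, Z]] ([Xtilde_lift_bracket]), since [dtau]
    commutes with lifts by the symmetry of second derivatives ([schwarz]).
    Hence the generated Lie algebra upstairs mirrors that of the frame
    downstairs. On [G] the generated fields have the form [a X + Z] with [Z]
    left-invariant; the linear field vanishes at the identity, so the rank
    condition there forces every left-invariant field to be one of the fields
    [Z], hence to be generated ([lie_algebra_generated]). The tangency of the
    brackets to the manifold, which usually comes from a computation in
    coordinates, is part of the rank condition of [G].

    Codimension. At a point where the frame of [G] has full rank, the lift
    of the linear field completes the lifted frame to a basis of the tangent
    space; left translation carries this to every point
    ([frame_tilde_codim1]).

    Minimality. Trajectories of the lifted system are the trajectories on [G]
    together with a primitive of the first control ([trajectory_lift],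
    [trajectory_proj]). The almost-Riemannian norm of a velocity is at most the
    norm of any control that realizes it, with equality almost everywhere for
    a minimal control. So the length of any competitor upstairs is at least
    the almost-Riemannian length of its projection, which is at least that of
    the minimal curve, which is the length of the minimal control
    ([AR_minimal_lift]). *)

(** * Calculus of maps of class C^k *)

Section Calculus.
Context {R : realType}.
Implicit Types E F H : normedModType R.

(** The explicit first-order remainder, from which the locality of the
    differential and the symmetry of second derivatives are proved. *)
Lemma diff_remainder {E F} (f : E -> F) x : differentiable f x ->
  forall e : R, 0 < e -> \forall h \near (0 : E),
    `|f (h + x) - (f x + 'd f x h)| <= e * `|h|.
Proof. by move=> /diff_locally /eqaddoP => h e e0; apply: h. Qed.

Lemma diff_of_remainder {E F} (f : E -> F) (df : {linear E -> F}) x :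
  continuous df ->
  (forall e : R, 0 < e -> \forall h \near (0 : E),
    `|f (h + x) - (f x + df h)| <= e * `|h|) ->
  differentiable f x /\ 'd f x = df :> (E -> F).
Proof.
move=> dfc h.
have hh : f \o shift x = cst (f x) + df +o_ 0 id.
  by apply/eqaddoP => e e0; apply: h.
have e : 'd f x = df :> (E -> F) by apply: diff_unique.
by split => //; apply/diff_locallyP; rewrite e.
Qed.

(** Differentiability and the differential depend only on the germ of the
    map. *)
Lemma near_eq_diff {E F} (f g : E -> F) x :
  (\forall y \near x, f y = g y) -> differentiable f x ->
  differentiable g x /\ 'd g x = 'd f x :> (E -> F).
Proof.
move=> fg df; apply: diff_of_remainder; first exact: diff_continuous.
move=> e e0; near=> h.
rewrite -(nbhs_singleton fg) (_ : g (h + x) = f (h + x)).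
  by near: h; apply: diff_remainder.
apply/esym; near: h.
have := fg; rewrite (near_shift 0 x) /=.
by apply: filterS => h; rewrite subr0.
Unshelve. all: by end_near. Qed.

(** Finite dimension, given by a basis with continuous coordinates; the
    chain rule for the predicate [Ck] holds under this condition on the
    intermediate space. *)
Definition fin_dim E := exists m (e : 'I_m -> E) (l : 'I_m -> {linear E -> R^o}),
  (forall j, continuous (l j)) /\ forall w, w = \sum_j l j w *: e j.

(** [Ck k] is a condition on the germs of the map at the points of the set,
    so it can be tested on singletons and is local. *)
Lemma Ck_pt {E F} k (U : set E) (f : E -> F) :
  Ck k U f <-> forall x, U x -> Ck k [set x] f.
Proof.
elim: k f => [|k IH] f /=.
  by split => h x Ux; [move=> _ -> ; exact: h|exact: (h x)].
split => [[df h] x Ux|h].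
  by split=> [_ ->|v]; [exact: df|exact: (IH _).1].
split => [x Ux|v]; first exact: (h x Ux).1.
by apply/IH => x Ux; apply: (h x Ux).2.
Qed.

Lemma Ck_eq {E F} k (U : set E) (f g : E -> F) : open U ->
  (forall x, U x -> f x = g x) -> Ck k U f -> Ck k U g.
Proof.
move=> oU; elim: k f g => [|k IH] f g fg /=.
  move=> cf x Ux; have nU : \forall y \near x, f y = g y.
    by apply: filterS (open_nbhs_nbhs (conj oU Ux)).
  have : g y @[y --> x] --> g x; last by [].
  by rewrite -(fg _ Ux); apply: cvg_trans (cf _ Ux); apply: near_eq_cvg.
have nU x : U x -> \forall y \near x, f y = g y.
  by move=> Ux; apply: filterS (open_nbhs_nbhs (conj oU Ux)).
move=> [df hf]; split => [x Ux|v]; first exact: (near_eq_diff (nU x Ux)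
  (df x Ux)).1.
apply: IH (hf v) => x Ux.
by rewrite (near_eq_diff (nU x Ux) (df x Ux)).2.
Qed.

Lemma Ck_le {E F} k (U : set E) (f : E -> F) : Ck k.+1 U f -> Ck k U f.
Proof.
elim: k f => [|k IH] f; first by move=> [df _] x Ux;
  apply/differentiable_continuous/df.
by move=> [df h]; split => // v; apply/IH/h.
Qed.

Lemma Ck_cst {E F} k (U : set E) (a : F) : Ck k U (fun=> a : F).
Proof.
elim: k a => [|k IH] a /=; first by move=> x _; apply: cvg_cst.
split=> [x _|v]; first exact: differentiable_cst.
by rewrite (_ : (fun _ => _) = fun=> 0) //; apply/funext => x; rewrite diff_cst.
Qed.

Lemma Ck_lin {E F H} k (U : set E) (f : E -> F) (l : {linear F -> H}) :
  open U -> continuous l -> Ck k U f -> Ck k U (l \o f).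
Proof.
move=> oU cl; elim: k f => [|k IH] f /=.
  by move=> cf x Ux; apply: continuous_comp; [exact: cf|exact: cl].
move=> [df h]; split=> [x Ux|v].
  by apply: differentiable_comp; [exact: df|exact: linear_differentiable].
apply: (Ck_eq oU) (IH _ (h v)) => x Ux.
rewrite diff_comp ?diff_lin //=; [exact: df|exact: linear_differentiable].
Qed.

Lemma CkD {E F} k (U : set E) (f g : E -> F) :
  open U -> Ck k U f -> Ck k U g -> Ck k U (f + g).
Proof.
move=> oU; elim: k f g => [|k IH] f g /=.
  by move=> cf cg x Ux; apply: continuousD; [exact: cf|exact: cg].
move=> [df hf] [dg hg]; split=> [x Ux|v].
  by apply: differentiableD; [exact: df|exact: dg].
apply: (Ck_eq oU) (IH _ _ (hf v) (hg v)) => x Ux.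
by rewrite diffD //; [exact: df|exact: dg].
Qed.

Lemma Ck_sum {E F} k (U : set E) m (f : 'I_m -> E -> F) :
  open U -> (forall i, Ck k U (f i)) -> Ck k U (\sum_i f i).
Proof.
move=> oU h; apply: (big_ind (Ck k U)) => // [|f1 f2]; [exact: Ck_cst|exact: CkD].
Qed.

Lemma diff_scale {E F} (a : E -> R^o) (b : E -> F) x :
  differentiable a x -> differentiable b x ->
  differentiable (fun y => a y *: b y) x /\
  forall v, 'd (fun y => a y *: b y) x v = a x *: 'd b x v + 'd a x v *: b x.
Proof.
move=> da db.
have bil : bilinear_for (GRing.Scale.Law.clone _ _ *:%R _)
   (GRing.Scale.Law.clone _ _ *:%R _) (fun (s : R^o) (w : F) => s *: w).
  split=> [u'|u] s y z /=.
  - by rewrite scalerDl scalerA.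
  - by rewrite scalerDr !scalerA mulrC.
pose bm := bilinear_isBilinear.Build R R^o F F _ _ _ bil.
pose B : {bilinear R^o -> F -> F} := HB.pack (fun (s : R^o) (w : F) => s *: w) bm.
have cB : continuous (fun p : R^o * F => B p.1 p.2) by move=> p;
  apply: scale_continuous.
have dB p : differentiable (fun p : R^o * F => B p.1 p.2) p
  by exact: differentiable_bilin.
have dp : differentiable (fun y => (a y, b y)) x by exact: differentiable_pair.
split; first exact: (differentiable_comp dp (dB _)).
move=> v.
rewrite (_ : (fun y => _) = (fun p : R^o * F => B p.1 p.2) \o (fun y => (a y,
  b y))) //.
by rewrite diff_comp // diff_bilin //= diff_pair.
Qed.

Lemma CkZ {E F} k (U : set E) (a : E -> R^o) (b : E -> F) :
  open U -> Ck k U a -> Ck k U b -> Ck k U (fun x => a x *: b x).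
Proof.
move=> oU; elim: k a b => [|k IH] a b.
  move=> ca cb x Ux; apply: continuousZ; [exact: ca|exact: cb].
move=> Ca Cb; have [da ha] := Ca; have [db hb] := Cb; split=> [x Ux|v].
  by have [] := diff_scale (da x Ux) (db x Ux).
have := CkD oU (IH _ _ (Ck_le Ca) (hb v)) (IH _ _ (ha v) (Ck_le Cb)).
apply: (Ck_eq oU) => x Ux.
by have [_ ->] := diff_scale (da x Ux) (db x Ux).
Qed.

Lemma Ck_pair {E F H} k (U : set E) (f : E -> F) (g : E -> H) :
  open U -> Ck k U f -> Ck k U g -> Ck k U (fun x => (f x, g x)).
Proof.
move=> oU; elim: k f g => [|k IH] f g /=.
  by move=> cf cg x Ux; apply: cvg_pair; [exact: cf|exact: cg].
move=> [df hf] [dg hg]; split=> [x Ux|v].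
  by apply: differentiable_pair; [exact: df|exact: dg].
apply: (Ck_eq oU) (IH _ _ (hf v) (hg v)) => x Ux.
by rewrite diff_pair //; [exact: df|exact: dg].
Qed.

(** Induction on [k]: expanding [w] in a basis, ['d g (f x) w] is a sum of
    products of coordinates of [w] and of functions ['d g _ (e j)] composed
    with [f], to which the induction hypothesis applies. *)
Lemma Ck_comp {E F H} k (U : set E) (V : set F) (f : E -> F) (g : F -> H) :
  fin_dim F -> open U -> open V -> (forall x, U x -> V (f x)) ->
  Ck k U f -> Ck k V g -> Ck k U (g \o f).
Proof.
move=> [m [e [l [cl el]]]] oU oV UV; elim: k g => [|k IH] g.
  move=> cf cg x Ux; apply: continuous_comp; [exact: cf|exact: (cg _ (UV _ Ux))].
move=> Cf [dg hg]; have [df hf] := Cf; split=> [x Ux|v].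
  by apply: differentiable_comp; [exact: df|exact: (dg _ (UV _ Ux))].
have : Ck k U (\sum_j fun x => (l j \o (fun x => 'd f x v)) x *: ((fun y
  => 'd g y (e j)) \o f) x).
  apply: Ck_sum => // j; apply: CkZ => //; first exact: (Ck_lin oU (cl j) (hf v)).
  by apply: IH; [exact: Ck_le Cf|exact: hg].
apply: (Ck_eq oU) => x Ux.
rewrite diff_comp /=; [|exact: df|exact: (dg _ (UV _ Ux))].
by rewrite [in RHS](el ('d f x v)) linear_sum fct_sumE; apply: eq_bigr => j _;
  rewrite linearZ.
Qed.

Lemma Ck_id {E} k (U : set E) : Ck k U (id : E -> E).
Proof.
case: k => [|k]; first by move=> x _; exact: cvg_id.
split => [x _|v]; first by apply: ex_diff.
rewrite (_ : (fun x => _) = fun=> v); first exact: Ck_cst.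
by apply/funext => x; rewrite diff_val.
Qed.

End Calculus.

(** * Smooth germs *)

Section SmoothAt.
Context {R : realType}.
Implicit Types E F H : normedModType R.

(** Smoothness on some neighbourhood of the point: the open sets on which
    [smooth_on] holds need not be carried along. *)
Definition smooth_at {E F} (f : E -> F) (x : E) :=
  exists2 U, open_nbhs x U & smooth_on U f.

(** Continuity is known only at the points of [U], so the preimage of [V] is
    open only after intersecting with [U]. *)
Lemma open_preimage_in (T S : topologicalType) (U : set T) (V : set S) (f : T
  -> S) :
  open U -> open V -> (forall x, U x -> {for x, continuous f}) ->
  open (U `&` f @^-1` V).
Proof.
move=> oU oV cf; rewrite openE => x [Ux Vx].
apply: filterI; first exact: open_nbhs_nbhs.
by apply: (cf x Ux); apply: open_nbhs_nbhs.
Qed.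

Lemma smooth_on_sub {E F} (U V : set E) (f : E -> F) :
  V `<=` U -> smooth_on U f -> smooth_on V f.
Proof.
by move=> VU h k; apply/Ck_pt => x Vx; apply: (Ck_pt _ _ _).1 (h k) x (VU _ Vx).
Qed.

Lemma smooth_at_near {E F} (f : E -> F) x :
  smooth_at f x -> \forall y \near x, smooth_at f y.
Proof.
by move=> [U [oU Ux] hU]; apply: filterS (open_nbhs_nbhs (conj oU Ux)) => y Uy;
  exists U.
Qed.

Lemma smooth_at_differentiable {E F} (f : E -> F) x :
  smooth_at f x -> differentiable f x.
Proof. by move=> [U [oU Ux] hU]; have [d _] := hU 1%N; exact: d. Qed.

Lemma smooth_at_continuous {E F} (f : E -> F) x :
  smooth_at f x -> {for x, continuous f}.
Proof. by move=> /smooth_at_differentiable; exact: differentiable_continuous. Qed.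

Lemma smooth_at_diff {E F} (f : E -> F) x v :
  smooth_at f x -> smooth_at (fun y => 'd f y v) x.
Proof. by move=> [U [oU Ux] hU]; exists U => // k; have [_] := hU k.+1;
  exact. Qed.

Lemma smooth_at_eq {E F} (f g : E -> F) x :
  (\forall y \near x, f y = g y) -> smooth_at f x -> smooth_at g x.
Proof.
move=> nfg; have : nbhs x [set y | f y = g y] by [].
rewrite nbhsE => -[V [oV Vx] fg] [U [oU Ux] hU].
exists (U `&` V); first by split => //; exact: openI.
move=> k; apply: (@Ck_eq _ _ _ _ _ f); [exact: openI|by move=> y [_ /fg]|].
exact: (smooth_on_sub (@subIsetl _ _ _) hU).
Qed.

Lemma smooth_at_comp {E F H} (f : E -> F) (g : F -> H) x : fin_dim F ->
  smooth_at f x -> smooth_at g (f x) -> smooth_at (g \o f) x.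
Proof.
move=> fF sf [V [oV Vx] hV]; have [U [oU Ux] hU] := sf.
have cf y : U y -> {for y, continuous f}.
  by move=> Uy; apply: smooth_at_continuous; exists U.
have oW : open (U `&` f @^-1` V) by exact: open_preimage_in.
exists (U `&` f @^-1` V) => // k.
apply: (@Ck_comp _ _ _ _ _ _ V) => //; last first.
  exact: (smooth_on_sub (@subIsetl _ _ _) hU).
by move=> y [].
Qed.

Lemma smooth_at_pair {E F H} (f : E -> F) (g : E -> H) x :
  smooth_at f x -> smooth_at g x -> smooth_at (fun y => (f y, g y)) x.
Proof.
move=> [U [oU Ux] hU] [V [oV Vx] hV].
exists (U `&` V); first by split => //; exact: openI.
move=> k; apply: Ck_pair; first exact: openI.
  exact: (smooth_on_sub (@subIsetl _ _ _) hU).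
exact: (smooth_on_sub (@subIsetr _ _ _) hV).
Qed.

Lemma smooth_atD {E F} (f g : E -> F) x :
  smooth_at f x -> smooth_at g x -> smooth_at (fun y => f y + g y) x.
Proof.
move=> [U [oU Ux] hU] [V [oV Vx] hV].
exists (U `&` V); first by split => //; exact: openI.
move=> k; apply: CkD; first exact: openI.
  exact: (smooth_on_sub (@subIsetl _ _ _) hU).
exact: (smooth_on_sub (@subIsetr _ _ _) hV).
Qed.

Lemma smooth_at_cst {E F} (a : F) (x : E) : smooth_at (fun=> a) x.
Proof. by exists setT; [split=> //; exact: openT|move=> k; exact: Ck_cst]. Qed.

Lemma smooth_at_id {E} (x : E) : smooth_at (fun y => y) x.
Proof. by exists setT; [split=> //; exact: openT|move=> k; exact: Ck_id]. Qed.

Lemma smooth_at_lin {E F H} (f : E -> F) (l : {linear F -> H}) x :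
  continuous l -> smooth_at f x -> smooth_at (l \o f) x.
Proof.
by move=> cl [U [oU Ux] hU]; exists U => // k; apply: Ck_lin.
Qed.

Lemma smooth_at_fst {E F H} (f : E -> F * H) x :
  smooth_at f x -> smooth_at (fun y => (f y).1) x.
Proof.
apply: (@smooth_at_lin E _ _ f (fst : {linear (F * H)%type -> F})).
by move=> ?; exact: cvg_fst.
Qed.

Lemma smooth_at_snd {E F H} (f : E -> F * H) x :
  smooth_at f x -> smooth_at (fun y => (f y).2) x.
Proof.
apply: (@smooth_at_lin E _ _ f (snd : {linear (F * H)%type -> H})).
by move=> ?; exact: cvg_snd.
Qed.

Lemma smooth_atZ {E F} (a : R) (f : E -> F) x :
  smooth_at f x -> smooth_at (fun y => a *: f y) x.
Proof.
apply: (@smooth_at_lin E _ _ f ( *:%R a : {linear F -> F})).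
by move=> ?; apply: scaler_continuous.
Qed.

Lemma fin_dim_R : @fin_dim R R^o.
Proof.
exists 1%N, (fun=> 1), (fun=> (idfun : {linear R^o -> R^o})); split.
  by move=> _ x; exact: cvg_id.
by move=> w; rewrite big_ord1 /= /GRing.scale /= mulr1.
Qed.

Lemma fin_dim_rV n : @fin_dim R 'rV[R]_n.
Proof.
have lin j : linear (fun w : 'rV[R]_n => w ord0 j : R^o).
  by move=> a u v; rewrite !mxE.
pose l j : {linear 'rV[R]_n -> R^o} := HB.pack
  (fun w : 'rV[R]_n => w ord0 j : R^o) (GRing.isLinear.Build _ _ _ _ _ (lin j)).
exists n, (fun j => delta_mx ord0 j), l.
split => [j /= x|w]; first exact: coord_continuous.
exact: row_sum_delta.
Qed.

Lemma fin_dim_pair E F : fin_dim E -> fin_dim F -> @fin_dim R (E * F)%type.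
Proof.
move=> [m [e [l [cl el]]]] [m' [e' [l' [cl' el']]]].
exists (m + m')%N, (fun j => match fintype.split j with inl i => (e i,
  0) | inr i => (0, e' i) end),
  (fun j => match fintype.split j with
            | inl i => (l i \o fst : {linear (E * F)%type -> R^o})
            | inr i => (l' i \o snd : {linear (E * F)%type -> R^o}) end).
split => [j|[w w']].
  case: fintype.split => i x /=; apply: continuous_comp.
  - exact: cvg_fst.
  - exact: cl.
  - exact: cvg_snd.
  - exact: cl'.
rewrite big_split_ord /=.
under eq_bigr do rewrite (unsplitK (inl _)) /=.
under [X in _ = _ + X]eq_bigr do rewrite (unsplitK (inr _)) /=.
rewrite [in LHS](el w) [in LHS](el' w'); apply/pair_equal_spec; split.
  rewrite raddf_sum (raddf_sum fst) /= [X in _ = _ + X]big1 ?addr0 //.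
  by move=> i _; rewrite scaler0.
rewrite raddf_sum (raddf_sum snd) /= [X in _ = X + _]big1 ?add0r //.
by move=> i _; rewrite scaler0.
Qed.

End SmoothAt.

(** * Symmetry of second derivatives *)

Section Schwarz.
Context {R : realType} {E : normedModType R}.
Implicit Types (f : E -> R^o) (x v w : E).

Lemma is_derive_line f c v (s : R) : differentiable f (c + s *: v) ->
  is_derive s (1 : R) (fun s : R => f (c + s *: v) : R) ('d f (c + s *: v) v).
Proof.
move=> df.
have dl : is_diff (s : R^o) (fun s : R^o => c + s *: v) (fun s => s *: v).
  have := is_diffD (is_diff_cst c (s : R^o)) (is_diff_scalel s v).
  by rewrite add0r.
have [ddl vdl] := dl; have d := differentiable_comp ddl df.
apply: DeriveDef; first exact: diff_derivable.
by rewrite deriveE // diff_comp //= vdl scale1r.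
Qed.

(** The mean value theorem in the direction [v] turns the second difference
    of [f] into an increment of the function ['d f _ v] in the direction
    [w]; the differentiability of that function at [x] gives its expansion. *)
Lemma second_difference f x v w :
  (\forall y \near x, differentiable f y) ->
  differentiable (fun y => 'd f y v : R^o) x ->
  forall e : R, 0 < e -> \forall h \near (0:R)^'+,
    `|f (x + h *: w + h *: v) - f (x + h *: w) - (f (x + h *: v) - f x)
      - h ^+ 2 * 'd (fun y => 'd f y v : R^o) x w| <= e * h ^+ 2.
Proof.
move=> nf dg e e0; pose g := fun y => 'd f y v : R^o.
(* the + 1 keeps the scale positive when both directions vanish *)
pose K := 2 * (`|v| + `|w| + 1).
have K0 : 0 < K by rewrite mulr_gt0 // ltr_wpDl // addr_ge0.
have eK0 : 0 < e / K by rewrite divr_gt0.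
have [r r0 rP] : exists2 r : R, 0 < r & forall k, `|k| < r ->
    differentiable f (x + k) /\ `|g (k + x) - (g x + 'd g x k)| <= e / K * `|k|.
  have /nbhs_norm0P[r1 /= r10 h1] : \forall k \near (0 : E),
    differentiable f (x + k).
    by apply/(nbhs0P (fun y => differentiable f y)).
  have /nbhs_norm0P[r2 /= r20 h2] := diff_remainder dg eK0.
  exists (Num.min r1 r2); first by rewrite lt_min r10.
  by move=> k; rewrite lt_min => /andP[k1 k2]; split; [exact: h1|exact: h2].
near=> h.
have h0 : 0 < h by [].
have hr : h * (`|v| + `|w| + 1) < r.
  rewrite -ltr_pdivlMr ?ltr_wpDl ?addr_ge0 //.
  near: h; apply: nbhs_right_lt; rewrite divr_gt0 // ltr_wpDl ?addr_ge0 //.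
have kb (s t : R) : 0 <= s <= h -> 0 <= t <= h ->
    `|s *: v + t *: w| <= h * (`|v| + `|w|).
  move=> /andP[s0 sh] /andP[t0 th].
  rewrite (le_trans (ler_normD _ _)) // !normrZ !ger0_norm // mulrDr.
  by rewrite lerD // ler_wpM2r.
have kr (s t : R) : 0 <= s <= h -> 0 <= t <= h -> `|s *: v + t *: w| < r.
  move=> hs ht; apply: le_lt_trans (kb _ _ hs ht) _; apply: lt_trans hr.
  by rewrite ltr_pM2l // ltrDl.
pose p s : R := f (x + h *: w + s *: v) - f (x + s *: v).
have dp (s : R) : 0 <= s <= h ->
    is_derive s (1:R) p (g (x + h *: w + s *: v) - g (x + s *: v)).
  move=> hs; apply: is_deriveB; apply: is_derive_line.
    rewrite -addrA [h *: w + _]addrC; apply: (rP _ _).1; apply: kr => //.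
    by rewrite lexx ltW.
  have := kr s 0 hs; rewrite scale0r addr0 lexx ltW // => /(_ isT) /rP[]//.
have [] := @MVT _ p (fun s => g (x + h *: w + s *: v) - g (x + s *: v)) 0 h h0.
- by move=> s; rewrite in_itv /= => /andP[s0 sh]; apply: dp; rewrite !ltW.
- apply: continuous_in_subspaceT => s; rewrite inE /= in_itv /= => hs.
  apply: differentiable_continuous; apply/derivable1_diffP.
  by case: (dp s hs).
move=> c; rewrite in_itv /= => /andP[c0 ch].
rewrite /p !scale0r !addr0 subr0 => mvt.
have hc : 0 <= c <= h by rewrite !ltW.
have hh : 0 <= h <= h by rewrite lexx ltW.
have h00 : 0 <= (0 : R) <= h by rewrite lexx ltW.
have -> : f (x + h *: w + h *: v) - f (x + h *: w) - (f (x + h *: v) - f x) =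
   (g (x + h *: w + c *: v) - g (x + c *: v)) * h.
  rewrite -mvt; ring.
have [_ r1] := rP _ (kr _ _ hc hh).
have [_ r2] := rP _ (kr _ _ hc h00).
have b1 := le_trans r1 (ler_wpM2l (ltW eK0) (kb _ _ hc hh)).
have b2 := le_trans r2 (ler_wpM2l (ltW eK0) (kb _ _ hc h00)).
have L (s : R) : 'd g x (c *: v + s *: w) = c * 'd g x v + s * 'd g x w.
  by rewrite linearD !linearZ.
move: b1 b2; rewrite !L -/g scale0r mul0r !addr0.
rewrite [c *: v + x]addrC [c *: v + _ + x]addrC [c *: v + _]addrC addrA.
move: (g (x + h *: w + c *: v)) (g (x + c *: v)) (g x) ('d g x v) ('d g x w)
  => g1 g2 g0 dv dw b1 b2.
have -> : (g1 - g2) * h - h ^+ 2 * dw =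
  h * ((g1 - (g0 + (c * dv + h * dw))) - (g2 - (g0 + c * dv))).
  ring.
rewrite normrM gtr0_norm // expr2 mulrCA ler_pM2l //.
apply: le_trans (ler_normB _ _) _; apply: le_trans (lerD b1 b2) _.
have -> : e / K * (h * (`|v| + `|w|)) + e / K * (h * (`|v| + `|w|)) =
  e * h * ((2 * (`|v| + `|w|)) / K) by ring.
rewrite ler_piMr // ?mulr_ge0 // ?ltW // ltr_pdivrMr // mul1r ltr_pM2l //.
by rewrite ltrDl.
Unshelve. all: by end_near. Qed.

(** The second difference is symmetric in [v] and [w], hence so is its
    leading coefficient. *)
Lemma schwarz f x v w : smooth_at f x ->
  'd (fun y => 'd f y v : R^o) x w = 'd (fun y => 'd f y w : R^o) x v.
Proof.
move=> sf.
have nf : \forall y \near x, differentiable f y.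
  by apply: filterS (smooth_at_near sf) => y; exact: smooth_at_differentiable.
have dv u : differentiable (fun y => 'd f y u : R^o) x.
  by apply: smooth_at_differentiable; exact: smooth_at_diff.
apply/eqP; rewrite -subr_eq0 -normr_le0; apply/ler_addgt0Pl => e e0;
  rewrite addr0.
have e20 : 0 < e / 2 by rewrite divr_gt0.
near (0:R)^'+ => h.
have h0 : 0 < h by [].
have h20 : 0 < h ^+ 2 by rewrite exprn_gt0.
have : `|f (x + h *: w + h *: v) - f (x + h *: w) - (f (x + h *: v) - f x)
      - h ^+ 2 * 'd (fun y => 'd f y v : R^o) x w| <= e / 2 * h ^+ 2.
  by near: h; apply: second_difference.
have : `|f (x + h *: v + h *: w) - f (x + h *: v) - (f (x + h *: w) - f x)
      - h ^+ 2 * 'd (fun y => 'd f y w : R^o) x v| <= e / 2 * h ^+ 2.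
  by near: h; apply: second_difference.
rewrite [x + h *: v + h *: w]addrAC.
move: (f _) (f _) (f _) (f _) ('d _ x w) ('d _ x v) => a b c d s t A B.
rewrite -(ler_pM2r h20) -[X in _ * X <= _](gtr0_norm h20) -normrM.
have -> : (s - t) * h ^+ 2 = (d - c - (b - a) - h ^+ 2 * t) - (d - b -
  (c - a) - h ^+ 2 * s) by ring.
apply: le_trans (ler_normB _ _) _; apply: le_trans (lerD A B) _.
by rewrite -mulrDl -splitr.
Unshelve. all: by end_near. Qed.
End Schwarz.

(** * Smooth maps between manifolds and products of manifolds *)

Section ChartCalculus.
Context {R : realType}.
Implicit Types E F H : normedModType R.

Section OneChart.
Context {M : topologicalType} {E : normedModType R}.
Variables (c : chart M E) (p : M).
Hypotheses (hc : is_chart c) (cp : chart_dom c p).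

Lemma chart_funK : chart_inv c (chart_fun c p) = p.
Proof. by case: hc => _ _ + _ _; apply. Qed.

Lemma near_chart_dom : \forall q \near p, chart_dom c q.
Proof. by apply: open_nbhs_nbhs; split=> //; case: hc. Qed.

Lemma chart_fun_continuous : {for p, continuous (chart_fun c)}.
Proof. by case: hc => _ _ _ + _; apply. Qed.

Lemma chart_inv_continuous : {for chart_fun c p, continuous (chart_inv c)}.
Proof. by case: hc => _ _ _ _; apply. Qed.

Lemma near_chart_image :
  \forall y \near chart_fun c p, (chart_fun c @` chart_dom c) y.
Proof. by apply: open_nbhs_nbhs; split; [case: hc|exists p]. Qed.

Lemma near_chart_inv (P : M -> Prop) :
  (\forall q \near p, P q) -> \forall y \near chart_fun c p, P (chart_inv c y).
Proof.
move=> nP; have : chart_inv c y @[y --> chart_fun c p] --> chart_inv c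
  (chart_fun c p).
  exact: chart_inv_continuous.
by rewrite chart_funK; apply.
Qed.

(** The image of the chart is open, so every nearby vector is the image of a
    point of the domain. *)
Lemma near_chart_invK : \forall y \near chart_fun c p,
  chart_dom c (chart_inv c y) /\ chart_fun c (chart_inv c y) = y.
Proof.
apply: filterS near_chart_image => y [q cq <-].
by case: hc => _ _ h _ _; rewrite h.
Qed.
End OneChart.

Definition findim_manifold {E} (M : smooth_space E) := fin_dim E /\ manifold M.

Section Manifold.
Context {E : normedModType R} {M : smooth_space E} (hM : findim_manifold M).

Lemma manifold_chart c : atlas M c -> is_chart c.
Proof. by case: hM => _ [_ _ + _ _]; apply. Qed.

Lemma manifold_cover (p : M) : exists2 c, atlas M c & chart_dom c p.
Proof. by case: hM => _ [_ _ _ + _]; apply. Qed.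

Lemma transition_smooth c d (p : M) : atlas M c -> atlas M d ->
  chart_dom c p -> chart_dom d p ->
  smooth_at (chart_fun d \o chart_inv c) (chart_fun c p).
Proof.
move=> Mc Md cp dp; case: hM => _ [_ _ _ _ /(_ c d Mc Md) h].
have hc := manifold_chart Mc; have hd := manifold_chart Md.
exists (chart_fun c @` (chart_dom c `&` chart_dom d)) => //; split;
  last by exists p.
rewrite openE => _ [q [cq dq] <-]; rewrite /interior /=.
near=> y.
have [q' cq' yq'] : (chart_fun c @` chart_dom c) y.
  by near: y; exact: near_chart_image.
exists q' => //; split=> //; rewrite -(chart_funK hc cq') yq'.
by near: y; apply: (near_chart_inv hc cq); exact: near_chart_dom.
Unshelve. all: by end_near. Qed.
End Manifold.

(** Smoothness of a map at a point, read in all pairs of charts. *)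
Definition smooth_map_at {E F} (M : smooth_space E) (N : smooth_space F)
    (f : M -> N) (p : M) :=
  {for p, continuous f} /\
  forall c d, atlas M c -> atlas N d -> chart_dom c p -> chart_dom d (f p) ->
    smooth_at (chart_fun d \o f \o chart_inv c) (chart_fun c p).

Lemma smooth_mapP {E F} (M : smooth_space E) (N : smooth_space F) (f : M -> N) :
  findim_manifold M -> findim_manifold N ->
  smooth_map f <-> forall p, smooth_map_at f p.
Proof.
move=> hM hN; split => [[cf sf] p|h].
  split=> [|c d Mc Nd cp dp]; first exact: cf.
  have hc := manifold_chart hM Mc; have hd := manifold_chart hN Nd.
  exists (chart_fun c @` (chart_dom c `&` f @^-1` chart_dom d)); last exact: sf.
  split; last by exists p.
  rewrite openE => _ [q [cq dq] <-]; rewrite /interior /=.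
  near=> y.
  have [q' cq' yq'] : (chart_fun c @` chart_dom c) y.
    by near: y; exact: near_chart_image.
  exists q' => //; split=> //; rewrite /= -(chart_funK hc cq') yq'.
  near: y; apply: (near_chart_inv hc cq (P := fun q => chart_dom d (f q))).
  by apply: (cf q); exact: near_chart_dom.
split=> [p|c d Mc Nd k]; first by have [] := h p.
apply/Ck_pt => _ [p [cp dp] <-].
have [_ /(_ c d Mc Nd cp dp) [U [oU Up] hU]] := h p.
exact: (Ck_pt _ _ _).1 (hU k) _ Up.
Unshelve. all: by end_near. Qed.

(** One pair of charts suffices: the other local expressions differ from it
    by transition maps. *)
Lemma smooth_map_at_chart {E F} (M : smooth_space E) (N : smooth_space F)
    (f : M -> N) p c d : findim_manifold M -> findim_manifold N ->
  {for p, continuous f} -> atlas M c -> atlas N d ->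
  chart_dom c p -> chart_dom d (f p) ->
  smooth_at (chart_fun d \o f \o chart_inv c) (chart_fun c p) ->
  smooth_map_at f p.
Proof.
move=> hM hN cf Mc Nd cp dp sf; split=> // c' d' Mc' Nd' cp' dp'.
have hc := manifold_chart hM Mc; have hd := manifold_chart hN Nd.
have hc' := manifold_chart hM Mc'.
have kp := chart_funK hc cp; have kp' := chart_funK hc' cp'.
have := @smooth_at_comp R E E F _ _ _ hM.1 (transition_smooth hM Mc' Mc cp' cp).
rewrite /= kp' => /(_ _ sf) s1.
have := @smooth_at_comp R E F F _ _ _ hN.1 s1.
rewrite /= kp' kp => /(_ _ (transition_smooth hN Nd Nd' dp dp')) s2.
apply: smooth_at_eq s2; near=> y => /=.
have cy : chart_dom c (chart_inv c' y).
  by near: y; apply: (near_chart_inv hc' cp'); exact: near_chart_dom.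
have dy : chart_dom d (f (chart_inv c' y)).
  near: y; apply: (near_chart_inv hc' cp' (P := fun q => chart_dom d (f q))).
  by apply: cf; exact: near_chart_dom.
by rewrite (chart_funK hc cy) (chart_funK hd dy).
Unshelve. all: by end_near. Qed.

Lemma smooth_map_at_comp {E F H} (M : smooth_space E) (N : smooth_space F)
    (P : smooth_space H) (f : M -> N) (g : N -> P) p :
  findim_manifold M -> findim_manifold N -> findim_manifold P ->
  smooth_map_at f p -> smooth_map_at g (f p) -> smooth_map_at (g \o f) p.
Proof.
move=> hM hN hP [cf sf] [cg sg].
have [c Mc cp] := manifold_cover hM p.
have [d Nd dp] := manifold_cover hN (f p).
have [e Pe ep] := manifold_cover hP (g (f p)).
have hc := manifold_chart hM Mc; have hd := manifold_chart hN Nd.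
apply: (smooth_map_at_chart hM hP _ Mc Pe) => //.
  exact: continuous_comp.
have := @smooth_at_comp R E F H _ _ _ hN.1 (sf _ _ Mc Nd cp dp).
rewrite /= chart_funK // => /(_ _ (sg _ _ Nd Pe dp ep)).
apply: smooth_at_eq; near=> y => /=.
rewrite chart_funK //.
near: y; apply: (near_chart_inv hc cp (P := fun q => chart_dom d (f q))).
by apply: cf; exact: near_chart_dom.
Unshelve. all: by end_near. Qed.

Lemma smooth_map_comp {E F H} (M : smooth_space E) (N : smooth_space F)
    (P : smooth_space H) (f : M -> N) (g : N -> P) :
  findim_manifold M -> findim_manifold N -> findim_manifold P ->
  smooth_map f -> smooth_map g -> smooth_map (fun p => g (f p)).
Proof.
move=> hM hN hP /(smooth_mapP _ hM hN) sf /(smooth_mapP _ hN hP) sg.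
by apply/smooth_mapP => // p; apply: (smooth_map_at_comp hM hN hP).
Qed.

Lemma smooth_map_id {E} (M : smooth_space E) : findim_manifold M ->
  smooth_map (M := M) (N := M) (fun p => p).
Proof.
move=> hM; apply/smooth_mapP => // p; split=> [|c d Mc Md cp dp];
  first exact: cvg_id.
exact: (transition_smooth hM Mc Md cp dp).
Qed.

Lemma smooth_map_cst {E F} (M : smooth_space E) (N : smooth_space F) (q : N) :
  findim_manifold M -> findim_manifold N -> smooth_map (M := M) (fun=> q).
Proof.
move=> hM hN; apply/smooth_mapP => // p; split=> [|c d Mc Nd cp dp].
  exact: cvg_cst.
exact: smooth_at_cst.
Qed.

Lemma hausdorff_prod (S T : topologicalType) :
  hausdorff_space S -> hausdorff_space T -> hausdorff_space (S * T)%type.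
Proof.
move=> hS hT [x y] [x' y'] cl; congr pair.
  apply: hS => A B nA nB.
  have [||[a b] [[/= aA _] [/= aB _]]] := cl (A `*` setT) (B `*` setT).
  - by exists (A, setT) => //; split=> //=; exact: filterT.
  - by exists (B, setT) => //; split=> //=; exact: filterT.
  by exists a.
apply: hT => A B nA nB.
have [||[a b] [[/= _ aA] [/= _ aB]]] := cl (setT `*` A) (setT `*` B).
- by exists (setT, A) => //; split=> //=; exact: filterT.
- by exists (setT, B) => //; split=> //=; exact: filterT.
by exists b.
Qed.

Lemma second_countable_prod (S T : topologicalType) :
  @second_countable S -> @second_countable T -> @second_countable (S * T)%type.
Proof.
move=> [A cA [oA bA]] [B cB [oB bB]].
exists ((fun UV => UV.1 `*` UV.2) @` (A `*` B)).
  exact/(card_le_trans (card_image_le _ _))/countableX.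
split => [_ [[U V] [/= /oA oU /oB oV] <-]|[x y] W].
  rewrite openE => -[u v] [/= Uu Vv]; exists (U, V) => //=.
  by split; apply: open_nbhs_nbhs.
move=> [[P Q] [/= /bA[U [AU Ux] UP] /bB[V [BV Vy] VQ]] PQW].
exists (U `*` V) => /=; first by split=> //; exists (U, V).
by move=> [u v] [/= Uu Vv]; apply: PQW; split; [exact: UP|exact: VQ].
Qed.

(** The intervals with rational end points form a countable basis. *)
Lemma second_countable_R : @second_countable R^o.
Proof.
exists [set U | exists q r : rat, U = `]ratr q, ratr r[%classic].
  rewrite (_ : [set U | _] = (fun p : rat * rat => `]ratr p.1,
    ratr p.2[%classic : set R) @` setT).
    exact/(card_le_trans (card_image_le _ _))/countableP.
  apply/seteqP; split => [U [q [r ->]]|_ [[q r] _ <-]]; first by exists (q, r).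
  by exists q, r.
split=> [_ [q [r ->]]|x A]; first exact: interval_open.
move=> /nbhs_ballP[e /= e0 xe].
have [q] := @rat_in_itvoo R (x - e) x (ltac:(by rewrite gtrBl)).
rewrite in_itv /= => /andP[q1 q2].
have [r] := @rat_in_itvoo R x (x + e) (ltac:(by rewrite ltrDl)).
rewrite in_itv /= => /andP[r1 r2].
exists `]ratr q, ratr r[%classic; first by split; [exists q,
  r|rewrite /= in_itv /= q2].
move=> y /=; rewrite in_itv /= => /andP[y1 y2]; apply: xe.
rewrite /ball /= ltr_distlC (lt_trans q1 y1) /=.
exact: lt_trans r2.
Qed.

(** The only chart of [real_space]. *)
Definition real_chart : chart R^o R^o :=
  Chart setT (fun x : R => x : R^o) (fun x : R^o => x : R).

Lemma real_space_manifold : findim_manifold (real_space (R := R)).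
Proof.
split; first exact: fin_dim_R.
split.
- exact: Rhausdorff.
- exact: second_countable_R.
- move=> _ ->; split=> //=; first exact: openT.
  + by rewrite image_id; exact: openT.
  + by move=> p _; exact: cvg_id.
  + by move=> p _; exact: cvg_id.
- by move=> p; eexists; first reflexivity.
- move=> _ _ -> -> k; exact: Ck_id.
Qed.

Section Product.
Context {E F : normedModType R} {M : smooth_space E} {N : smooth_space F}.
Hypotheses (hM : findim_manifold M) (hN : findim_manifold N).

Lemma prod_chart_image (S T : topologicalType) (c : chart S E) (d
  : chart T F) U V :
  chart_fun (prod_chart c d) @` (U `*` V) =
  (chart_fun c @` U) `*` (chart_fun d @` V).
Proof.
apply/seteqP; split => [_ [[p q] [/= Up Vq] <-]|[x y] [/= [p Up <-] [q Vq <-]]].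
  by split; [exists p|exists q].
by exists (p, q).
Qed.

Lemma open_prod (S T : topologicalType) (U : set S) (V : set T) :
  open U -> open V -> open (U `*` V).
Proof.
move=> oU oV; rewrite openE => -[u v] [/= Uu Vv]; exists (U, V) => //=.
by split; apply: open_nbhs_nbhs.
Qed.

Lemma prod_is_chart (c : chart M E) (d : chart N F) :
  is_chart c -> is_chart d -> is_chart (prod_chart c d).
Proof.
move=> [c1 c2 c3 c4 c5] [d1 d2 d3 d4 d5]; split.
- exact: open_prod.
- by rewrite prod_chart_image; exact: open_prod.
- by move=> [p q] [/= cp dq]; rewrite c3 // d3.
- move=> [p q] [/= cp dq]; apply: cvg_pair.
    by apply: (@continuous_comp _ _ _ fst (chart_fun c) (p, q));
      [exact: cvg_fst|exact: c4].
  by apply: (@continuous_comp _ _ _ snd (chart_fun d) (p, q));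
    [exact: cvg_snd|exact: d4].
- move=> [p q] [/= cp dq]; apply: cvg_pair.
    by apply: (@continuous_comp _ _ _ fst (chart_inv c) (chart_fun c p,
      chart_fun d q));
     [exact: cvg_fst|exact: c5].
  by apply: (@continuous_comp _ _ _ snd (chart_inv d) (chart_fun c p,
    chart_fun d q));
     [exact: cvg_snd|exact: d5].
Qed.

Lemma smooth_at_id_fst (z : E * F) : smooth_at (fun y : E * F => y.1) z.
Proof. exact: (smooth_at_fst (smooth_at_id z)). Qed.

Lemma smooth_at_id_snd (z : E * F) : smooth_at (fun y : E * F => y.2) z.
Proof. exact: (smooth_at_snd (smooth_at_id z)). Qed.

Lemma prod_manifold : findim_manifold (prod_space M N).
Proof.
have [fE [hsM scM _ cM _]] := hM; have [fF [hsN scN _ cN _]] := hN.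
split; first exact: fin_dim_pair.
split.
- exact: hausdorff_prod.
- exact: second_countable_prod.
- move=> _ [c [d [Mc Nd ->]]]; apply: prod_is_chart.
    exact: (manifold_chart hM).
  exact: (manifold_chart hN).
- move=> [p q]; have [c Mc cp] := cM p; have [d Nd dq] := cN q.
  by exists (prod_chart c d) => //; exists c, d.
- move=> _ _ [c [d [Mc Nd ->]]] [c' [d' [Mc' Nd' ->]]] k.
  apply/Ck_pt => _ [[p q] [[/= cp dq] [/= cp' dq']] <-].
  have [U [oU Up] hU] : smooth_at (chart_fun (prod_chart c' d') \o chart_inv
    (prod_chart c d))
      (chart_fun (prod_chart c d) (p, q)); last exact: (Ck_pt _ _ _).1
        (hU k) _ Up.
  apply: smooth_at_pair.
    exact: (smooth_at_comp fE (smooth_at_id_fst (_, chart_fun d q))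
      (transition_smooth hM Mc Mc' cp cp')).
  exact: (smooth_at_comp fF (smooth_at_id_snd (chart_fun c p, _))
    (transition_smooth hN Nd Nd' dq dq')).
Qed.

Lemma smooth_map_fst : smooth_map (M := prod_space M N) (N := M) fst.
Proof.
apply/smooth_mapP => [|//|[p q]]; first exact: prod_manifold.
split=> [|_ c' [c [d [Mc Nd ->]]] Mc' [/= cp dq] cp']; first exact: cvg_fst.
exact: (smooth_at_comp hM.1 (smooth_at_id_fst (_, chart_fun d q))
  (transition_smooth hM Mc Mc' cp cp')).
Qed.

Lemma smooth_map_snd : smooth_map (M := prod_space M N) (N := N) snd.
Proof.
apply/smooth_mapP => [|//|[p q]]; first exact: prod_manifold.
split=> [|_ d' [c [d [Mc Nd ->]]] Nd' [/= cp dq] dq']; first exact: cvg_snd.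
exact: (smooth_at_comp hN.1 (smooth_at_id_snd (chart_fun c p, _))
  (transition_smooth hN Nd Nd' dq dq')).
Qed.

Lemma smooth_map_pair {H} (P : smooth_space H) (f : P -> M) (g : P -> N) :
  findim_manifold P -> smooth_map f -> smooth_map g ->
  smooth_map (M := P) (N := prod_space M N) (fun p => (f p, g p)).
Proof.
move=> hP /(smooth_mapP _ hP hM) sf /(smooth_mapP _ hP hN) sg.
apply/smooth_mapP => [//||p]; first exact: prod_manifold.
have [cf hf] := sf p; have [cg hg] := sg p.
split=> [|e _ Pe [c [d [Mc Nd ->]]] ep [/= cp dp]]; first exact: cvg_pair.
by apply: smooth_at_pair; [exact: hf|exact: hg].
Qed.
End Product.

End ChartCalculus.

(** * Partial derivatives *)

Section Slices.
Context {R : realType}.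
Implicit Types E F H : normedModType R.

Lemma near_eq_diffE {E F} (f g : E -> F) x :
  (\forall y \near x, f y = g y) -> differentiable f x ->
  'd g x = 'd f x :> (E -> F).
Proof. by move=> fg df; have [] := near_eq_diff fg df. Qed.

Lemma diff_lincomb {E} (f g : E -> R^o) (a : R) x v :
  differentiable f x -> differentiable g x ->
  'd (fun y => a * f y + g y : R^o) x v = a * 'd f x v + 'd g x v.
Proof.
move=> df dg; have e := diffD (differentiableZ a df) dg.
transitivity (('d (a *: f) x \+ 'd g x) v); first by rewrite -e.
by rewrite [LHS]/= (diffZ a df).
Qed.

Lemma is_diff_pairl {E F} (x : E) (y : F) :
  differentiable (fun x' : E => (x', y)) x /\
  'd (fun x' : E => (x', y)) x = (fun v => (v, 0)) :> (E -> E * F).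
Proof.
have di : differentiable (fun x' : E => x') x by apply: ex_diff.
have dc : differentiable (fun x' : E => y) x by exact: differentiable_cst.
split; first exact: differentiable_pair.
rewrite diff_pair //; apply/funext => v; rewrite (diff_cst y) /=.
by congr (_, _); rewrite (@diff_val _ _ _ _ _ _ _ (is_diff_id x)).
Qed.

Lemma is_diff_pairr {E F} (x : E) (y : F) :
  differentiable (fun y' : F => (x, y')) y /\
  'd (fun y' : F => (x, y')) y = (fun w => (0, w)) :> (F -> E * F).
Proof.
have di : differentiable (fun x' : F => x') y by apply: ex_diff.
have dc : differentiable (fun x' : F => x) y by exact: differentiable_cst.
split; first exact: differentiable_pair.
rewrite diff_pair //; apply/funext => v; rewrite (diff_cst x) /=.
by congr (_, _); rewrite (@diff_val _ _ _ _ _ _ _ (is_diff_id y)).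
Qed.

Lemma diff_slicel {E F H} (h : E * F -> H) x y v : differentiable h (x, y) ->
  differentiable (fun x' => h (x', y)) x /\
  'd (fun x' => h (x', y)) x v = 'd h (x, y) (v, 0).
Proof.
move=> dh; have [d1 d2] := is_diff_pairl x y.
split; first exact: (differentiable_comp d1).
by rewrite (_ : (fun x' => _) = h \o (fun x' => (x', y))) // diff_comp //= d2.
Qed.

Lemma diff_slicer {E F H} (h : E * F -> H) x y w : differentiable h (x, y) ->
  differentiable (fun y' => h (x, y')) y /\
  'd (fun y' => h (x, y')) y w = 'd h (x, y) (0, w).
Proof.
move=> dh; have [d1 d2] := is_diff_pairr x y.
split; first exact: (differentiable_comp d1).
by rewrite (_ : (fun y' => _) = h \o (fun y' => (x, y'))) // diff_comp //= d2.
Qed.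

Lemma smooth_at_near_slicel {E F H} (h : E * F -> H) x y :
  smooth_at h (x, y) -> \forall x' \near x, smooth_at h (x', y).
Proof.
move=> /smooth_at_near nh.
by apply: (cvg_pair cvg_id (cvg_cst y) : (fun x' => (x', y)) @ x --> (x, y)).
Qed.

Lemma smooth_at_near_slicer {E F H} (h : E * F -> H) x y :
  smooth_at h (x, y) -> \forall y' \near y, smooth_at h (x, y').
Proof.
move=> /smooth_at_near nh.
by apply: (cvg_pair (cvg_cst x) cvg_id : (fun y' => (x, y')) @ y --> (x, y)).
Qed.

(** Both iterated partial derivatives are second derivatives of [h] on the
    product, in the directions [(v, 0)] and [(0, w)], so they agree by
    symmetry. *)
Lemma mixed_partials {E F} (h : E * F -> R^o) x y v w : smooth_at h (x, y) ->
  'd (fun y' => 'd (fun x' => h (x', y')) x v : R^o) y w =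
  'd (fun x' => 'd (fun y' => h (x', y')) y w : R^o) x v.
Proof.
move=> sh.
have d1 : differentiable (fun z => 'd h z (v, 0) : R^o) (x, y).
  exact/smooth_at_differentiable/smooth_at_diff.
have d2 : differentiable (fun z => 'd h z (0, w) : R^o) (x, y).
  exact/smooth_at_differentiable/smooth_at_diff.
have [e1 f1] := diff_slicer w d1; have [e2 f2] := diff_slicel v d2.
have -> : 'd (fun y' => 'd (fun x' => h (x', y')) x v : R^o) y =
   'd (fun y' => 'd h (x, y') (v, 0) : R^o) y :> (F -> R^o).
  apply: near_eq_diffE e1; apply: filterS (smooth_at_near_slicer sh) => y' sh'.
  by have [] := diff_slicel v (smooth_at_differentiable sh').
have -> : 'd (fun x' => 'd (fun y' => h (x', y')) y w : R^o) x =
   'd (fun x' => 'd h (x', y) (0, w) : R^o) x :> (E -> R^o).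
  apply: near_eq_diffE e2; apply: filterS (smooth_at_near_slicel sh) => y' sh'.
  by have [] := diff_slicer w (smooth_at_differentiable sh').
by rewrite f1 f2; apply: schwarz.
Qed.
End Slices.

(** * Tangent vectors and vector fields *)

Section Tangent.
Context {R : realType}.
Implicit Types E F H : normedModType R.

Section Functions.
Context {E : normedModType R} {M : smooth_space E} (hM : findim_manifold M).

Lemma smooth_fun_at (f : M -> R) c p : smooth_fun f -> atlas M c ->
  chart_dom c p -> smooth_at (f \o chart_inv c : E -> R^o) (chart_fun c p).
Proof.
move=> /(smooth_mapP _ hM real_space_manifold) /(_ p) [_ h] Mc cp.
exact: (h c real_chart Mc).
Qed.

Lemma smooth_funP (f : M -> R) :
  (forall p, exists c, [/\ atlas M c, chart_dom c p &
    smooth_at (f \o chart_inv c : E -> R^o) (chart_fun c p)]) -> smooth_fun f.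
Proof.
move=> h; apply/smooth_mapP => [//||p]; first exact: real_space_manifold.
have [c [Mc cp sf]] := h p.
have hc := manifold_chart hM Mc.
apply: (@smooth_map_at_chart R E R^o M real_space f p c
  real_chart hM real_space_manifold) => //.
have : (f \o chart_inv c) (chart_fun c q) @[q --> p] --> (f \o chart_inv c)
  (chart_fun c p).
  apply: (@continuous_comp _ _ _ (chart_fun c) (f \o chart_inv c : E -> R^o)).
    exact: chart_fun_continuous.
  exact: smooth_at_continuous sf.
rewrite /= chart_funK // => cf; have : f q @[q --> p] --> f p; last exact.
apply: cvg_trans cf; apply: near_eq_cvg; near=> q.
rewrite (chart_funK hc) //; near: q; exact: near_chart_dom.
Unshelve. all: by end_near. Qed.

Lemma smooth_fun_lin (a : R) (f g : M -> R) : smooth_fun f -> smooth_fun g ->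
  smooth_fun (fun p => a * f p + g p).
Proof.
move=> sf sg; apply: smooth_funP => p; have [c Mc cp] := manifold_cover hM p.
exists c; split=> //; apply: smooth_atD; last exact: smooth_fun_at.
by apply: smooth_atZ; exact: smooth_fun_at.
Qed.

Lemma smooth_fun_cst (a : R) : smooth_fun (fun _ : M => a).
Proof. by apply: smooth_map_cst => //; exact: real_space_manifold. Qed.

Lemma on_smoothT (D : (M -> R) -> R) f : smooth_fun f -> on_smooth D f = D f.
Proof. by move=> sf; rewrite /on_smooth asboolT. Qed.

Lemma on_smoothF (D : (M -> R) -> R) f : ~ smooth_fun f -> on_smooth D f = 0.
Proof. by move=> sf; rewrite /on_smooth asboolF. Qed.

(** Two functionals that vanish outside smooth functions are equal as soon
    as they agree on smooth functions. *)
Lemma on_smooth_eq (D D' : (M -> R) -> R) :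
  (forall f, smooth_fun f -> D f = D' f) -> on_smooth D = on_smooth D'
    :> functional M.
Proof.
move=> h; apply/funext => f; rewrite /on_smooth.
by case: asboolP => // sf; exact: h.
Qed.

Lemma chart_vector_lin (c : chart M E) (p : M) a v w (f : M -> R) :
  chart_vector c p (a *: v + w) f = a * chart_vector c p v f + chart_vector c p
    w f.
Proof.
rewrite /chart_vector /on_smooth; case: asboolP => _; last by rewrite mulr0 addr0.
by rewrite linearP.
Qed.
End Functions.

(** The chain rule: the tangent map of [phi] acts on coordinates through the
    differential of its local expression. *)
Lemma dmap_chart_vector {E F} (M : smooth_space E) (N : smooth_space F)
    (phi : M -> N) c d p v : findim_manifold M -> findim_manifold N ->
  smooth_map phi -> atlas M c -> atlas N d -> chart_dom c p ->
  chart_dom d (phi p) ->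
  dmap phi (chart_vector c p v) = chart_vector d (phi p)
    ('d (chart_fun d \o phi \o chart_inv c) (chart_fun c p) v).
Proof.
move=> hM hN sphi Mc Nd cp dp; apply: on_smooth_eq => h sh.
have hc := manifold_chart hM Mc; have hd := manifold_chart hN Nd.
rewrite /chart_vector on_smoothT; last first.
  exact: (smooth_map_comp hM hN real_space_manifold sphi sh).
have [cphi /(_ c d Mc Nd cp dp) sphi'] := (smooth_mapP _ hM hN).1 sphi p.
have dphi := smooth_at_differentiable sphi'.
have dh := smooth_at_differentiable (smooth_fun_at hN sh Nd dp).
pose psi := (chart_fun d \o phi \o chart_inv c);
  pose h' : F -> R^o := h \o chart_inv d.
have e : psi (chart_fun c p) = chart_fun d (phi p) by rewrite /psi /= chart_funK.
rewrite -/h' in dh *; rewrite -/psi in dphi *; rewrite -e in dh *.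
transitivity ('d (h' \o psi) (chart_fun c p) v); last by rewrite diff_comp.
rewrite (near_eq_diffE (f := h' \o psi) _ (differentiable_comp dphi dh)) //.
near=> y; rewrite /h' /psi /= chart_funK //.
near: y; apply: (near_chart_inv hc cp (P := fun q => chart_dom d (phi q))).
by apply: cphi; exact: near_chart_dom.
Unshelve. all: by end_near. Qed.

Section TangentSpace.
Context {E : normedModType R} {M : smooth_space E} (hM : findim_manifold M).
Implicit Types (A B : operator M) (f g : M -> R).

Lemma tangent_nsmooth (p : M) (D : functional M) f : tangent p D
  -> ~ smooth_fun f -> D f = 0.
Proof. by move=> [c [v [_ _ ->]]] nf; exact: on_smoothF. Qed.

(** A tangent vector has coordinates in every chart at its base point; this
    is the tangent map of the identity, read in two charts. *)
Lemma tangent_chart (p : M) (D : functional M) c : tangent p D -> atlas M c ->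
  chart_dom c p -> exists v, D = chart_vector c p v.
Proof.
move=> [d [v [Md dp Dd]]] Mc cp.
have : D = dmap (fun p => p) D.
  by rewrite Dd; apply: on_smooth_eq => f sf; rewrite /chart_vector on_smoothT.
rewrite {2}Dd (dmap_chart_vector v hM hM (smooth_map_id hM) Md Mc) // => ->.
by eexists.
Qed.

Lemma tangent_chart_vector (c : chart M E) (p : M) v : atlas M c
  -> chart_dom c p ->
  tangent p (chart_vector c p v).
Proof. by move=> Mc cp; exists c, v. Qed.

Lemma tangent_lin (p : M) a (D D' : functional M) : tangent p D -> tangent p D' ->
  tangent p (fun f => a * D f + D' f).
Proof.
move=> tD tD'; have [c Mc cp] := manifold_cover hM p.
have [v ->] := tangent_chart tD Mc cp; have [w ->] := tangent_chart tD' Mc cp.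
exists c, (a *: v + w); split=> //; apply/funext => f;
  by rewrite chart_vector_lin.
Qed.

Lemma tangent0 (p : M) : tangent p (fun=> 0).
Proof.
have [c Mc cp] := manifold_cover hM p; exists c, 0; split=> //.
apply/funext => f; rewrite /chart_vector /on_smooth; case: asboolP => // _.
by rewrite linear0.
Qed.

Lemma tangent_linear (p : M) (D : functional M) a f g : tangent p D ->
  smooth_fun f -> smooth_fun g -> D (fun q => a * f q + g q) = a * D f + D g.
Proof.
move=> [c [v [Mc cp ->]]] sf sg; rewrite /chart_vector !on_smoothT //;
  last exact: smooth_fun_lin.
pose f' : E -> R^o := f \o chart_inv c; pose g' : E -> R^o := g \o chart_inv c.
have df : differentiable f' (chart_fun c p).
  exact: smooth_at_differentiable (smooth_fun_at hM sf Mc cp).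
have dg : differentiable g' (chart_fun c p).
  exact: smooth_at_differentiable (smooth_fun_at hM sg Mc cp).
exact: (diff_lincomb a v df dg).
Qed.

Lemma tangent_cst (p : M) (D : functional M) a : tangent p D -> D (fun=> a) = 0.
Proof.
move=> [c [v [Mc cp ->]]]; rewrite /chart_vector on_smoothT;
  last exact: smooth_fun_cst.
rewrite (_ : (_ \o _) = (cst a : E -> R^o)) // diff_cst //.
Qed.

Lemma tangent_field_cst A (a : R) : vector_field A -> A (fun=> a) = fun=> 0.
Proof.
by move=> [tA _]; apply/funext => p; exact: (tangent_cst a (tA p)).
Qed.

Lemma tangent_field_nsmooth A f : vector_field A -> ~ smooth_fun f
  -> A f = fun=> 0.
Proof.
by move=> [tA _] nf; apply/funext => p; apply: (tangent_nsmooth (tA p)).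
Qed.

Lemma tangent_field_lin A a f g : vector_field A -> smooth_fun f -> smooth_fun g
  ->
  A (fun q => a * f q + g q) = fun p => a * A f p + A g p.
Proof.
by move=> [tA _] sf sg; apply/funext => p; exact: (tangent_linear a (tA p)).
Qed.

Lemma tangent_field_op_lin a A B : vector_field A -> vector_field B ->
  vector_field (op_lin a A B).
Proof.
move=> [tA sA] [tB sB]; split=> [p|f sf]; first exact: tangent_lin.
by apply: (smooth_fun_lin hM); [exact: sA|exact: sB].
Qed.

Lemma velocity_chart (gamma : R -> M) c t : {for t, continuous gamma} ->
  atlas M c -> chart_dom c (gamma t) ->
  derivable (chart_fun c \o gamma : R^o -> E) t 1 ->
  velocity gamma t = chart_vector c (gamma t) (derive1 (chart_fun c \o gamma
    : R^o -> E) t).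
Proof.
move=> cg Mc cp dg; apply: on_smooth_eq => f sf.
have hc := manifold_chart hM Mc.
have dg' : differentiable (chart_fun c \o gamma : R^o -> E) t
  by exact/derivable1_diffP.
have df := smooth_at_differentiable (smooth_fun_at hM sf Mc cp).
have [d1 d2] : differentiable (f \o gamma : R^o -> R^o) t /\
   'd (f \o gamma : R^o -> R^o) t =
   'd ((f \o chart_inv c : E -> R^o) \o (chart_fun c \o gamma : R^o -> E)) t :>
     (R^o -> R^o).
  apply: near_eq_diff (differentiable_comp dg' df); near=> s => /=.
  by rewrite chart_funK //; near: s; apply: cg; exact: near_chart_dom.
by rewrite !derive1E' // d2 diff_comp.
Unshelve. all: by end_near. Qed.
End TangentSpace.

Lemma tangent_dmap {E F} (M : smooth_space E) (N : smooth_space F)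
    (phi : M -> N) p D : findim_manifold M -> findim_manifold N ->
  smooth_map phi -> tangent p D -> tangent (phi p) (dmap phi D).
Proof.
move=> hM hN sphi [c [v [Mc cp ->]]]; have [d Nd dp] := manifold_cover hN (phi p).
by rewrite (dmap_chart_vector v hM hN sphi Mc Nd cp dp);
  exact: tangent_chart_vector.
Qed.

(** In charts, the function is a partial derivative of the local expression
    of [f], restricted to a slice. *)
Lemma smooth_partial {E F} (M : smooth_space E) (N : smooth_space F)
    (f : M * N -> R) d q v : findim_manifold M -> findim_manifold N ->
  smooth_fun (M := prod_space M N) f -> atlas N d -> chart_dom d q ->
  smooth_fun (fun p : M => 'd (fun y => f (p, chart_inv d y) : R^o)
    (chart_fun d q) v).
Proof.
move=> hM hN sf Nd dq; apply: smooth_funP => // p.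
have [c Mc cp] := manifold_cover hM p; exists c; split=> //.
have hMN := prod_manifold hM hN.
have sh : smooth_at (f \o chart_inv (prod_chart c d) : E * F -> R^o)
    (chart_fun c p, chart_fun d q).
  by apply: (smooth_fun_at hMN sf (c := prod_chart c d) (p := (p, q))) => //;
    exists c, d.
set h := (X in smooth_at X _) in sh.
have s1 : smooth_at (fun x => (x, chart_fun d q)) (chart_fun c p).
  by apply: smooth_at_pair; [exact: smooth_at_id|exact: smooth_at_cst].
have := smooth_at_comp (fin_dim_pair hM.1 hN.1) s1 (smooth_at_diff (0, v) sh).
apply: smooth_at_eq; apply: filterS (smooth_at_near_slicel sh) => x shx.
by have [_ e] := diff_slicer v (smooth_at_differentiable shx); exact: (esym e).
Qed.

End Tangent.

(** * Velocities of curves in a product with the line *)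

Section Curves.
Context {R : realType}.
Implicit Types E F H : normedModType R.

Section Curve.
Context {E : normedModType R} {M : smooth_space E} (hM : findim_manifold M).

Let hMR := prod_manifold hM (@real_space_manifold R).

Lemma smooth_slice (f : M * R -> R) (s : R) :
  smooth_fun (M := prod_space M real_space) f -> smooth_fun (fun g : M => f (g,
    s)).
Proof.
move=> sf; apply: (smooth_map_comp (N := prod_space M real_space) (f := fun g
  : M => (g, s)) hM hMR (@real_space_manifold R) _ sf).
apply: (smooth_map_pair hM (@real_space_manifold R) hM (smooth_map_id hM)).
exact: (smooth_map_cst (N := real_space) s hM (@real_space_manifold R)).
Qed.

Lemma smooth_fun_prod_at (f : M * R -> R) (c : chart M E) g (t : R) :
  smooth_fun (M := prod_space M real_space) f -> atlas M c -> chart_dom c g ->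
  smooth_at (f \o chart_inv (prod_chart c real_chart) : E * R^o -> R^o)
    (chart_fun c g, t).
Proof.
move=> sf Mc cg.
apply: (smooth_fun_at hMR sf (c := prod_chart c real_chart) (p := (g, t))) => //.
by exists c, real_chart.
Qed.

Lemma velocity_tau (f : M * R -> R) (c : chart M E) g (s : R) :
  smooth_fun (M := prod_space M real_space) f -> atlas M c -> chart_dom c g ->
  velocity (M := prod_space M real_space) (fun s => (g, s)) s f =
  'd (f \o chart_inv (prod_chart c real_chart) : E * R^o -> R^o) (chart_fun c g,
    s) (0, 1).
Proof.
move=> sf Mc cg; rewrite /velocity on_smoothT //.
have dh : differentiable (f \o chart_inv (prod_chart c real_chart) : E * R^o
  -> R^o) (chart_fun c g, s).
  exact: smooth_at_differentiable (smooth_fun_prod_at s sf Mc cg).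
have [d1 <-] := diff_slicer (1 : R^o) dh.
have hc := manifold_chart hM Mc.
rewrite (_ : (f \o _) = (fun y' : R^o => (f \o chart_inv
  (prod_chart c real_chart)) (chart_fun c g, y')) :> (R^o -> R^o)).
  by rewrite derive1E'.
by apply/funext => y /=; rewrite chart_funK.
Qed.

(** The two components of the velocity of a curve in the product act
    separately on functions: this is what makes the field dtau and the lifts
    of fields of [M] add up along curves. *)
Lemma velocity_pair (al : R -> M) (be : R -> R) t (f : M * R -> R) :
  {for t, continuous al} -> curve_derivable al t -> derivable (be : R^o
    -> R^o) t 1 ->
  smooth_fun (M := prod_space M real_space) f ->
  velocity (M := prod_space M real_space) (fun s => (al s, be s)) t f =
  velocity al t (fun g => f (g, be t)) +
  derive1 (be : R^o -> R^o) t *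
    velocity (M := prod_space M real_space) (fun s => (al t, s)) (be t) f.
Proof.
move=> ca [c [Mc cp da]] db sf.
rewrite (velocity_tau _ sf Mc cp).
have da' : differentiable (chart_fun c \o al : R^o -> E) t
  by exact/derivable1_diffP.
have db' : differentiable (be : R^o -> R^o) t by exact/derivable1_diffP.
have dp := differentiable_pair da' db'.
have cab : {for t, continuous (fun s => (al s, be s) : M * R^o)}.
  exact: (cvg_pair ca (differentiable_continuous db')).
rewrite (velocity_chart hMR (c := prod_chart c real_chart) cab) //; last 2 first.
  by exists c, real_chart.
  by exact/derivable1_diffP.
rewrite (velocity_chart hM ca Mc cp da).
rewrite /chart_vector !on_smoothT //; last exact: smooth_slice.
have -> : derive1 (chart_fun (prod_chart c real_chart) \o (fun s => (al s,
  be s)) : R^o -> E * R^o) t =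
  (derive1 (chart_fun c \o al : R^o -> E) t, derive1 (be : R^o -> R^o) t).
  by rewrite !derive1E' // (diff_pair da' db').
set v := derive1 _ _; set w := derive1 _ _.
set h := (f \o chart_inv (prod_chart c real_chart) : E * R^o -> R^o).
have dh : differentiable h (chart_fun c (al t), be t : R^o).
  exact: smooth_at_differentiable (smooth_fun_prod_at (be t) sf Mc cp).
have [_ e] := diff_slicel v dh.
rewrite [X in _ = X + _](_ : _ = 'd h (chart_fun c (al t), be t : R^o) (v, 0)) //.
rewrite -[w * _]/(w *: _) -linearZ -linearD /=; congr ('d h _ (_, _)).
  by rewrite -[RHS]/(v + w *: 0) scaler0 addr0.
by rewrite -[RHS]/(0 + w * 1) mulr1 add0r.
Qed.

End Curve.
End Curves.

(** * Left-invariant vector fields on a Lie group *)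

Section LieGroups.
Context {R : realType} {E : normedModType R} (G : lie_data E).
Hypotheses (fE : fin_dim E) (hG : lie_group G).
Implicit Types (X Y : operator G) (D : functional G) (g h : G) (f : G -> R).

Lemma lie_manifold : findim_manifold G.
Proof. by split => //; case: hG. Qed.
Local Notation hM := lie_manifold.

Lemma lmulA : associative (@lmul _ _ G). Proof. by case: hG => _ []. Qed.
Lemma lmul1g : left_id (lone G) (@lmul _ _ G). Proof. by case: hG => _ []. Qed.
Lemma lmulg1 : right_id (lone G) (@lmul _ _ G). Proof. by case: hG => _ []. Qed.
Lemma lmulVg : left_inverse (lone G) (@linv _ _ G) (@lmul _ _ G).
Proof. by case: hG => _ []. Qed.
Lemma lmulgV : right_inverse (lone G) (@linv _ _ G) (@lmul _ _ G).
Proof. by case: hG => _ []. Qed.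

Lemma smooth_lmul2 {F : normedModType R} (M : smooth_space F) (a b : M -> G) :
  findim_manifold M -> smooth_map a -> smooth_map b ->
  smooth_map (M := M) (N := G) (fun p => lmul (a p) (b p)).
Proof.
move=> hM' sa sb; have [_ _ sm _] := hG.
exact: (smooth_map_comp hM' (prod_manifold hM hM) hM
  (smooth_map_pair hM hM hM' sa sb) sm).
Qed.

Lemma smooth_lmul g : smooth_map (M := G) (N := G) (lmul g).
Proof.
apply: (smooth_lmul2 (a := fun=> g) (b := fun h => h) hM).
  exact: (smooth_map_cst g hM hM).
exact: smooth_map_id hM.
Qed.

Lemma smooth_fun_lmul f g : smooth_fun f -> smooth_fun (f \o lmul g).
Proof. exact: (smooth_map_comp hM hM (@real_space_manifold R)
  (smooth_lmul g)). Qed.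

Lemma dmap_lmul g D f : smooth_fun f -> dmap (N := G) (lmul g) D f = D
  (f \o lmul g).
Proof. by move=> sf; rewrite /dmap on_smoothT. Qed.

Lemma dmap_lmulM g h D :
  dmap (N := G) (lmul g) (dmap (N := G) (lmul h) D) = dmap (N := G) (lmul
    (lmul g h)) D.
Proof.
apply: on_smooth_eq => f sf; rewrite dmap_lmul; last exact: smooth_fun_lmul.
by congr D; apply/funext => k /=; rewrite lmulA.
Qed.

Lemma dmap_lmul1 p D : tangent p D -> dmap (N := G) (lmul (lone G)) D = D.
Proof.
move=> [c [v [_ _ ->]]]; apply: on_smooth_eq => f sf.
rewrite (_ : f \o _ = f); first by rewrite /chart_vector on_smoothT.
by apply/funext => h /=; rewrite lmul1g.
Qed.

Lemma left_field_invariant D : left_invariant (left_field D).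
Proof. by move=> g h; exact: dmap_lmulM. Qed.

Lemma left_field1 D : tangent (lone G) D -> at_point (left_field D) (lone G) = D.
Proof. exact: dmap_lmul1. Qed.

(** The field is obtained by differentiating [f (g h)] with respect to [h]
    at the identity, and this function is smooth in both variables. *)
Lemma left_field_smooth D f : tangent (lone G) D -> smooth_fun f ->
  smooth_fun (left_field D f).
Proof.
move=> [c [v [Mc ce ->]]] sf.
rewrite (_ : left_field _ _ = fun g => 'd (fun y => f (lmul g (chart_inv c y))
  : R^o) (chart_fun c (lone G)) v).
  apply: (smooth_partial (N := G) (f := fun gh => f
    (lmul gh.1 gh.2)) v hM hM _ Mc ce).
  have [_ _ sm _] := hG.
  exact: (smooth_map_comp (prod_manifold hM hM) hM
    (@real_space_manifold R) sm sf).
apply/funext => g; rewrite /left_field dmap_lmul // /chart_vector on_smoothT //.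
exact: smooth_fun_lmul.
Qed.

Lemma left_field_lie D : tangent (lone G) D -> lie_algebra (left_field D).
Proof.
move=> tD; split; last exact: left_field_invariant.
split=> [g|f]; last exact: left_field_smooth.
rewrite -[g in tangent g]lmulg1; exact: (tangent_dmap hM hM (smooth_lmul g) tD).
Qed.

Lemma left_invariant_ext X Y : left_invariant X -> left_invariant Y ->
  at_point X (lone G) = at_point Y (lone G) -> X = Y.
Proof.
move=> lX lY e; apply/funext => f; apply/funext => g.
have := lX g (lone G); have := lY g (lone G); rewrite e lmulg1 => -> eX.
by rewrite -[LHS]/(at_point X g f) -eX.
Qed.

Lemma lie_algebraE X : lie_algebra X -> X = left_field (at_point X (lone G)).
Proof.
move=> [[tX _] lX]; apply: left_invariant_ext => //;
  first exact: left_field_invariant.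
by rewrite left_field1.
Qed.

Lemma left_invariantE X g h f : left_invariant X -> smooth_fun f ->
  X (f \o lmul g) h = X f (lmul g h).
Proof. by move=> lX sf; rewrite -[RHS]/(at_point X _ f) -lX dmap_lmul. Qed.

Lemma lie_algebra_lin a X Y : lie_algebra X -> lie_algebra Y ->
  lie_algebra (op_lin a X Y).
Proof.
move=> [vX lX] [vY lY]; split; first exact: (tangent_field_op_lin hM).
move=> g h; apply/funext => f; rewrite /at_point /op_lin.
have := lX g h; have := lY g h => /(congr1 (@^~ f)) /= eY /(congr1 (@^~ f)) /= eX.
move: eX eY; rewrite /dmap /on_smooth /at_point; case: asboolP => _ <- <- //.
by rewrite mulr0 addr0.
Qed.

Lemma lie_algebra0 : lie_algebra (op_zero G).
Proof.
split; first split=> [p|f sf].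
- exact: (tangent0 hM).
- exact: (smooth_fun_cst hM).
- by move=> g h; apply/funext => f; rewrite /dmap /on_smooth; case: asboolP.
Qed.

(** The tangency of a bracket to the manifold is a separate matter: below it
    comes from the rank condition, which spares the chart computation. *)
Lemma bracket_invariant X Y : lie_algebra X -> lie_algebra Y ->
  left_invariant (bracket X Y).
Proof.
move=> [vX lX] [vY lY] g h; apply/funext => f; rewrite /at_point /bracket.
rewrite /dmap /on_smooth; case: asboolP => sf; last first.
  rewrite (tangent_field_nsmooth vX sf) (tangent_field_nsmooth vY sf).
  by rewrite !(tangent_field_cst hM) // subr0.
have comm (Z : operator G) : left_invariant Z -> Z (f \o lmul g) = Z f \o lmul g.
  by move=> lZ; apply/funext => k; exact: left_invariantE.
rewrite comm // comm // (left_invariantE _ _ lX) ?(left_invariantE _ _ lY) //.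
  by case: vX => _; apply.
by case: vY => _; apply.
Qed.

End LieGroups.

(** * The semi-direct product as a Lie group *)

Lemma derive1_translation {R : realType} (t : R) :
  derivable (fun s : R^o => t + s : R^o) 0 1 /\
  derive1 (fun s : R^o => t + s : R^o) 0 = 1.
Proof.
have d1 : derivable (cst t : R^o -> R^o) 0 1 by exact: derivable_cst.
have d2 : derivable (id : R^o -> R^o) 0 1 by exact: derivable_id.
split; first exact: derivableD d1 d2.
rewrite derive1E; have := deriveD d1 d2; rewrite derive_cst derive_id add0r.
exact.
Qed.

Lemma diff_slicer_shift {R : realType} {E F H : normedModType R}
  (h : E * F -> H) x y w : differentiable h (x, y) ->
  'd (fun y' => h (x, y + y')) 0 w = 'd h (x, y) (0, w).
Proof.
move=> dh.
have [dl vl] := is_diffD (is_diff_cst y (0 : F)) (is_diff_id (0 : F)).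
have dh0 : differentiable h (x, y + 0) by rewrite [y + 0]addr0.
have [dr er] := diff_slicer w dh0.
have e := diff_comp dl dr.
refine (etrans (congr1 (@^~ w) e) _); rewrite {e} /comp vl.
transitivity ('d h (x, y + 0) (0, w)); last by rewrite [y + 0]addr0.
have vw : ((0 : F -> F) + id) w = w by rewrite -[LHS]/(0 + w) add0r.
by rewrite vw er.
Qed.

Section Semidirect.
Context {R : realType} {E : normedModType R} (G : lie_data E) (X : operator G)
  (phi : R -> G -> G).
Hypotheses (fE : fin_dim E) (hG : lie_group G) (vX : vector_field X)
  (hphi : linear_flow X phi).
Local Notation Gt := (semidirect phi).
Local Notation RR := (@real_space R).
Local Notation hR := (@real_space_manifold R).

Let hM : findim_manifold G. Proof. exact: lie_manifold. Qed.
Let hMt : findim_manifold Gt. Proof. exact: (prod_manifold hM hR). Qed.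
Let fEt : fin_dim (E * R^o)%type. Proof. by case: hMt. Qed.

Lemma flow0 g : phi 0 g = g. Proof. by case: hphi => _ _ []. Qed.
Lemma flowD s t g : phi (s + t) g = phi s (phi t g).
Proof. by case: hphi => _ _ []. Qed.
Lemma flowM t g h : phi t (lmul g h) = lmul (phi t g) (phi t h).
Proof. by case: hphi. Qed.

Lemma flow1 t : phi t (lone G) = lone G.
Proof.
have e : lmul (phi t (lone G)) (phi t (lone G)) = phi t (lone G).
  by rewrite -flowM (lmul1g hG).
have := congr1 (lmul (linv (phi t (lone G)))) e.
by rewrite (lmulA hG) (lmulVg hG) (lmul1g hG).
Qed.

Lemma smooth_flow {F : normedModType R} (N : smooth_space F) (a : N -> R) (b : N
  -> G) :
  findim_manifold N -> smooth_fun a -> smooth_map b ->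
  smooth_map (M := N) (N := G) (fun p => phi (a p) (b p)).
Proof.
move=> hN sa sb; have [sphi _ _ _] := hphi.
exact: (smooth_map_comp hN (prod_manifold hR hM) hM
  (smooth_map_pair hR hM hN sa sb) sphi).
Qed.

Lemma smooth_fst {F : normedModType R} (N : smooth_space F) (a : N -> Gt) :
  findim_manifold N -> smooth_map (N := Gt) a -> smooth_map (N := G) (fun p =>
    (a p).1).
Proof. by move=> hN sa; exact: (smooth_map_comp hN hMt hM sa
  (smooth_map_fst hM hR)). Qed.

Lemma smooth_snd {F : normedModType R} (N : smooth_space F) (a : N -> Gt) :
  findim_manifold N -> smooth_map (N := Gt) a -> smooth_fun (fun p => (a p).2).
Proof. by move=> hN sa; exact: (smooth_map_comp hN hMt hR sa
  (smooth_map_snd hM hR)). Qed.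

Lemma smooth_funD {F : normedModType R} (N : smooth_space F) (a b : N -> R) :
  findim_manifold N -> smooth_fun a -> smooth_fun b -> smooth_fun (fun p
    => a p + b p).
Proof.
move=> hN sa sb; have := smooth_fun_lin hN 1 sa sb.
by under [X in smooth_fun X]eq_fun do rewrite mul1r.
Qed.

Lemma smooth_funN {F : normedModType R} (N : smooth_space F) (a : N -> R) :
  findim_manifold N -> smooth_fun a -> smooth_fun (fun p => - a p).
Proof.
move=> hN sa; have := smooth_fun_lin hN (-1) sa (smooth_fun_cst hN 0).
by under [X in smooth_fun X]eq_fun do rewrite mulN1r addr0.
Qed.

Lemma semidirect_lie_group : lie_group Gt.
Proof.
have hMM := prod_manifold hMt hMt.
have s1 := smooth_map_fst hMt hMt; have s2 := smooth_map_snd hMt hMt.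
split.
- by case: hMt.
- split.
  + move=> [g1 t1] [g2 t2] [g3 t3]; congr (_, _) => /=; last by rewrite addrA.
    by rewrite flowM (addrC t2) flowD (lmulA hG).
  + by move=> [g t]; congr (_, _) => /=; [rewrite flow1
    (lmul1g hG)|rewrite add0r].
  + by move=> [g t]; congr (_, _) => /=; [rewrite flow0
    (lmulg1 hG)|rewrite addr0].
  + move=> [g t]; congr (_, _) => /=; last by rewrite addNr.
    by rewrite -flowD subrr flow0 (lmulVg hG).
  + move=> [g t]; congr (_, _) => /=; last by rewrite subrr.
    by rewrite -flowM (lmulgV hG) flow1.
- apply: (smooth_map_pair hM hR hMM).
    apply: (smooth_lmul2 fE hG hMM); last exact: smooth_fst.
    apply: smooth_flow => //; first exact: (smooth_snd hMM s2).
    exact: (smooth_fst hMM s1).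
  by apply: (smooth_funD hMM); apply: (smooth_snd hMM).
- have si := smooth_map_id hMt.
  have sn : smooth_fun (fun p : Gt => - p.2) by apply: (smooth_funN hMt);
    exact: (smooth_snd hMt si).
  apply: (smooth_map_pair hM hR hMt) => //.
  apply: smooth_flow => //; have [_ _ _ sv] := hG.
  exact: (smooth_map_comp hMt hM hM (smooth_fst hMt si) sv).
Qed.
Local Notation hGt := semidirect_lie_group.

Lemma smooth_curve (gamma : R -> G) t : smooth_map (M := RR) gamma ->
  {for t, continuous gamma} /\ curve_derivable gamma t.
Proof.
move=> /(smooth_mapP _ hR hM) /(_ t) [cg sg]; split=> //.
have [c Mc cp] := manifold_cover hM (gamma t).
exists c; split=> //; apply/derivable1_diffP; apply: smooth_at_differentiable.
exact: (sg real_chart c).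
Qed.

Lemma velocity_flow g : velocity (phi^~ g) 0 = at_point X g.
Proof. by case: hphi => _ /(_ 0 g) -> _ _; rewrite flow0. Qed.

Lemma lift_fieldE (Z : operator G) (f : Gt -> R) p : smooth_fun f ->
  lift_field phi Z f p = Z (fun g => f (g, p.2)) p.1.
Proof. by move=> sf; rewrite /lift_field /dmap on_smoothT. Qed.

Lemma smooth_insert (t : R) : smooth_map (M := G) (N := Gt) (fun g => (g, t)).
Proof.
apply: (smooth_map_pair hM hR hM (smooth_map_id hM)).
exact: (smooth_map_cst (N := RR) t hM hR).
Qed.

Lemma lift_tangent Z p : vector_field Z -> tangent p (at_point
  (lift_field phi Z) p).
Proof.
move=> [tZ _]; have := tangent_dmap hM hMt (smooth_insert p.2) (tZ p.1).
by case: p.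
Qed.

(** On the slice with parameter [t], left translation by [(g1, t1)] acts as
    left translation of [G] by [phi t g1]; hence the lift of an invariant
    field is invariant. It preserves smoothness because an invariant field
    differentiates [f (g h)] in [h] at the identity, and the parameters
    enter smoothly. *)
Lemma lift_lie (Z : operator G) : lie_algebra Z -> lie_algebra (lift_field phi Z).
Proof.
move=> lZ; have [vZ iZ] := lZ; split; first split=> [p|f sf].
- exact: lift_tangent.
- have [c [v [Mc ce De]]] := vZ.1 (lone G).
  have hMtG := prod_manifold hMt hM.
  rewrite (_ : lift_field phi Z f = fun p => 'd (fun y => f (lmul p.1
    (chart_inv c y), p.2) : R^o) (chart_fun c (lone G)) v).
    apply: (smooth_partial (N := G) (f := fun ph : Gt * G => f
      (lmul ph.1.1 ph.2, ph.1.2)) v hMt hM _ Mc ce).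
    have s1 := smooth_map_fst hMt hM.
    have sl : smooth_map (M := prod_space Gt G) (N := Gt) (fun ph =>
      (lmul ph.1.1 ph.2, ph.1.2) : Gt); last first.
      exact: (smooth_map_comp hMtG hMt hR sl sf).
    apply: (smooth_map_pair hM hR hMtG); last exact: (smooth_snd hMtG s1).
    apply: (smooth_lmul2 fE hG hMtG); first exact: (smooth_fst hMtG s1).
    exact: (smooth_map_snd hMt hM).
  apply/funext => p; rewrite lift_fieldE // (lie_algebraE fE hG lZ) De.
  have ss := smooth_slice hM p.2 sf.
  rewrite /left_field dmap_lmul // /chart_vector on_smoothT //.
  exact: smooth_fun_lmul.
move=> [g1 t1] [g t]; apply: on_smooth_eq => f sf.
rewrite /at_point lift_fieldE; last exact: (smooth_fun_lmul fEt hGt).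
exact: (left_invariantE (phi t g1) g iZ (smooth_slice hM (t1 + t) sf)).
Qed.

Lemma dtauE f p c : smooth_fun f -> atlas G c -> chart_dom c p.1 ->
  dtau phi f p = 'd (f \o chart_inv (prod_chart c real_chart) : E * R^o -> R^o)
    (chart_fun c p.1, p.2) (0, 1).
Proof. by move=> sf Mc cp; exact: velocity_tau. Qed.

(** In the chart with coordinate [tau], the field is the constant vector
    [(0, 1)]. *)
Lemma dtau_vector : vector_field (dtau phi).
Proof.
split=> [[g t]|f sf].
  have [c Mc cg] := manifold_cover hM g.
  pose e := prod_chart c real_chart.
  exists e, (0, 1); split => //; first by exists c; eexists.
  by apply: on_smooth_eq => f sf; rewrite -(dtauE (p := (g,
    t)) sf Mc cg) /dtau /velocity on_smoothT.
have hMtR := prod_manifold hMt hR.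
rewrite (_ : dtau phi f = fun p : Gt => 'd (fun y : R^o => f (p.1,
  p.2 + y) : R^o) 0 1).
  apply: (smooth_partial (N := RR) (f := fun ph : Gt * R => f (ph.1.1,
    ph.1.2 + ph.2)) (d := real_chart) (q := 0) 1 hMt hR) => //.
  have s1 := smooth_map_fst hMt hR.
  have sl : smooth_map (M := prod_space Gt RR) (N := Gt) (fun ph => (ph.1.1,
    ph.1.2 + ph.2) : Gt); last first.
    exact: (smooth_map_comp hMtR hMt hR sl sf).
  apply: (smooth_map_pair hM hR hMtR); first exact: (smooth_fst hMtR s1).
  apply: (smooth_funD hMtR); first exact: (smooth_snd hMtR s1).
  exact: (smooth_map_snd hMt hR).
apply/funext => p; have [c Mc cp] := manifold_cover hM p.1.
rewrite (dtauE sf Mc cp).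
set h := (_ \o _).
have dh : differentiable (h : E * R^o -> R^o) (chart_fun c p.1, p.2 : R^o).
  exact: smooth_at_differentiable (smooth_fun_prod_at hM p.2 sf Mc cp).
have hE : (fun y : R^o => f (p.1, p.2 + y) : R^o) = (fun y : R^o => h
  (chart_fun c p.1, p.2 + y)).
  by apply/funext => y; rewrite /h /= (chart_funK (manifold_chart hM Mc) cp).
have e1 := diff_slicer_shift (1 : R^o) dh.
by rewrite -e1 hE.
Qed.

Lemma dtau1_tangent : tangent (lone Gt) (at_point (dtau phi) (lone Gt)).
Proof. by case: dtau_vector => + _; apply. Qed.

Lemma Xtilde_lie : lie_algebra (Xtilde phi).
Proof. exact: (left_field_lie fEt hGt dtau1_tangent). Qed.

Lemma Xtilde1 : at_point (Xtilde phi) (lone Gt) = at_point (dtau phi) (lone Gt).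
Proof. exact: (left_field1 hGt dtau1_tangent). Qed.

(** Right multiplication of [(g, t)] by [(e, s)] gives [(phi s g, t + s)];
    differentiating at [s = 0] yields the two terms. *)
Lemma Xtilde_decomp : Xtilde phi = op_lin 1 (lift_field phi X) (dtau phi).
Proof.
apply/funext => f; apply/funext => -[g t].
have [sf|nsf] := pselect (smooth_fun f); last first.
  by rewrite /op_lin /Xtilde /left_field /lift_field /dtau /velocity /dmap
    !on_smoothF // mulr0 addr0.
rewrite /op_lin mul1r lift_fieldE //= /Xtilde /left_field dmap_lmul //.
rewrite /at_point /dtau /velocity on_smoothT; last exact:
  (smooth_fun_lmul fEt hGt).
have [ca da] : {for 0, continuous (phi^~ g)} /\ curve_derivable (phi^~ g) 0.
  apply: smooth_curve; apply: (smooth_flow hR); first exact: (smooth_map_id hR).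
  exact: (smooth_map_cst g hR hM).
have [db vb] := derive1_translation t.
have := velocity_pair hM ca da db sf; rewrite velocity_flow addr0 flow0.
rewrite /velocity !on_smoothT // => e.
transitivity (derive1 (f \o (fun s => (phi s g, t + s)) : R^o -> R^o) 0).
  apply: (congr1 (fun F : R^o -> R^o => derive1 F 0)).
  by apply/funext => s /=; rewrite (lmulg1 hG).
rewrite e; apply: (congr1 (fun a => X _ g + a)).
by rewrite vb mul1r.
Qed.

End Semidirect.

(** * Lie algebras of vector fields *)

Section Brackets.
Context {R : realType} {E : normedModType R} (M : smooth_space E).
Hypothesis hM : findim_manifold M.
Implicit Types (A B Z : operator M) (f : M -> R).

Lemma bracket_nsmooth A B f : vector_field A -> vector_field B ->
  ~ smooth_fun f -> bracket A B f = fun=> 0.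
Proof.
move=> vA vB nf; apply/funext => p; rewrite /bracket.
by rewrite !(tangent_field_nsmooth _ nf) // !(tangent_field_cst hM) // subr0.
Qed.

Lemma bracket_smooth A B f : vector_field A -> vector_field B ->
  smooth_fun f -> smooth_fun (bracket A B f).
Proof.
move=> [_ sA] [_ sB] sf.
have := smooth_fun_lin hM (-1) (sB _ (sA _ sf)) (sA _ (sB _ sf)).
by under [X in smooth_fun X]eq_fun do rewrite mulN1r addrC.
Qed.

Lemma bracket_comb a b A Z Z' : vector_field A -> vector_field Z
  -> vector_field Z' ->
  bracket (op_lin a A Z) (op_lin b A Z') =
  op_lin a (bracket A Z') (op_lin (- b) (bracket A Z) (bracket Z Z')).
Proof.
move=> vA vZ vZ'; apply/funext => f; have [sf|nf] := pselect (smooth_fun f);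
  last first.
  rewrite bracket_nsmooth //; try exact: (tangent_field_op_lin hM).
  by apply/funext => p; rewrite /op_lin !bracket_nsmooth // !mulr0 !addr0.
apply/funext => p; rewrite /bracket /op_lin.
have [_ sA] := vA; have [_ sZ] := vZ; have [_ sZ'] := vZ'.
rewrite !(tangent_field_lin hM) //; try by [exact: sA|exact: sZ|exact: sZ'].
ring.
Qed.

Lemma LA_subalgebra (S : set (operator M)) : lie_subalgebra (LA S).
Proof.
split=> [L [L0 _ _] _ //|a A B hA hB L lL SL|A B hA hB L lL SL].
  by have [_ h _] := lL; apply: h; [exact: hA|exact: hB].
by have [_ _ h] := lL; apply: h; [exact: hA|exact: hB].
Qed.

Lemma LA_gen (S : set (operator M)) : S `<=` LA S.
Proof. by move=> Z SZ L _; apply. Qed.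

(** If [A] normalizes a Lie algebra [K] of fields, then the multiples of [A]
    and [K] together form a Lie algebra. It is applied on [G] with the
    linear field and on the semi-direct product with [Xtilde]. *)
Lemma extension_subalgebra A (K : set (operator M)) : vector_field A ->
  (forall Z, K Z -> vector_field Z) -> K (op_zero M) ->
  (forall a Z Z', K Z -> K Z' -> K (op_lin a Z Z')) ->
  (forall Z Z', K Z -> K Z' -> K (bracket Z Z')) ->
  (forall Z, K Z -> K (bracket A Z)) ->
  lie_subalgebra [set W | exists a Z, K Z /\ W = op_lin a A Z].
Proof.
move=> vA vK K0 Kl Kb KA; split.
- exists 0, (op_zero M); split=> //; apply/funext => f; apply/funext => p.
  by rewrite /op_lin mul0r add0r.
- move=> a _ _ [b [Z [KZ ->]]] [b' [Z' [KZ' ->]]].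
  exists (a * b + b'), (op_lin a Z Z'); split; first exact: Kl.
  by apply/funext => f; apply/funext => p; rewrite /op_lin; ring.
- move=> _ _ [b [Z [KZ ->]]] [b' [Z' [KZ' ->]]].
  exists 0, (op_lin b (bracket A Z') (op_lin (- b') (bracket A Z)
    (bracket Z Z'))).
  split; first by apply: (Kl); [exact: KA|apply: (Kl); [exact: KA|exact: Kb]].
  rewrite bracket_comb; try by [exact: vA|exact: vK].
  by apply/funext => f; apply/funext => p; rewrite [RHS]/op_lin mul0r add0r.
Qed.

(** The operator counterpart of [fcomb]: a linear combination of fields with
    constant coefficients. *)
Definition ocomb k (a : 'I_k -> R) (F : 'I_k -> operator M) : operator M :=
  fun f p => fcomb a (fun i => at_point (F i) p) f.

Lemma ocomb_recl k (a : 'I_k.+1 -> R) (F : 'I_k.+1 -> operator M) :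
  ocomb a F = op_lin (a ord0) (F ord0)
    (ocomb (fun i => a (lift ord0 i)) (fun i => F (lift ord0 i))).
Proof.
by apply/funext => f; apply/funext => p; rewrite /ocomb /fcomb big_ord_recl.
Qed.
End Brackets.

Lemma frame0 {R : realType} {E : normedModType R} (M : smooth_space E) m
  (X : operator M) (Y : 'I_m -> operator M) : frame X Y ord0 = X.
Proof. by rewrite /frame unlift_none. Qed.

Lemma frameS {R : realType} {E : normedModType R} (M : smooth_space E) m
  (X : operator M) (Y : 'I_m -> operator M) i : frame X Y (lift ord0 i) = Y i.
Proof. by rewrite /frame liftK. Qed.

Lemma ocomb_frame {R : realType} {E : normedModType R} (M : smooth_space E) m
  (X : operator M) (Y : 'I_m -> operator M) (a : 'I_m.+1 -> R) :
  ocomb a (frame X Y) = op_lin (a ord0) X (ocomb (fun i => a (lift ord0 i)) Y).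
Proof.
rewrite ocomb_recl frame0; congr (op_lin _ _ (ocomb _ _)).
by apply/funext => i; rewrite frameS.
Qed.

Section LieFields.
Context {R : realType} {E : normedModType R} (G : lie_data E).
Hypotheses (fE : fin_dim E) (hG : lie_group G).

Let hM : findim_manifold G. Proof. exact: lie_manifold. Qed.

(** A vector at [p] is moved to the identity and extended from there by
    translation. *)
Lemma lie_algebra_at p : [set at_point Z p | Z in lie_algebra (G
  := G)] = tangent p.
Proof.
apply/seteqP; split=> [_ [Z [[tZ _] _] <-]|D tD]; first exact: tZ.
have tD' : tangent (lone G) (dmap (N := G) (lmul (linv p)) D).
  rewrite -(lmulVg hG p); exact: (tangent_dmap hM hM (smooth_lmul fE hG _) tD).
exists (left_field (dmap (N := G) (lmul (linv p)) D));
  first exact: left_field_lie.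
rewrite -[LHS]/(dmap (N := G) (lmul p) (dmap (N := G) (lmul (linv p)) D)).
rewrite (dmap_lmulM fE hG) (lmulgV hG).
by have [c [v [Mc cp _]]] := tD; exact: (dmap_lmul1 hG tD).
Qed.

Lemma lie_algebra_comb k (a : 'I_k -> R) (F : 'I_k -> operator G) :
  (forall i, lie_algebra (F i)) -> lie_algebra (ocomb a F).
Proof.
elim: k a F => [|k IH] a F lF.
  rewrite (_ : ocomb a F = op_zero G); first exact: lie_algebra0.
  by apply/funext => f; apply/funext => p; rewrite /ocomb /fcomb big_ord0.
by rewrite ocomb_recl; apply: lie_algebra_lin => //; exact: IH.
Qed.

(** By invariance a field is determined by its value at any point, so that
    questions on left-invariant fields can be settled at a convenient point. *)
Lemma lie_algebra_eq_at (V W : operator G) p : lie_algebra V -> lie_algebra W ->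
  at_point V p = at_point W p -> V = W.
Proof.
move=> [_ lV] [_ lW] e; apply: (left_invariant_ext hG lV lW).
by rewrite -(lmulVg hG p) -lV -lW e.
Qed.
End LieFields.

(** * Lifted fields and their brackets *)

Section SemidirectFields.
Context {R : realType} {E : normedModType R} (G : lie_data E) (X : operator G)
  (phi : R -> G -> G).
Hypotheses (fE : fin_dim E) (hG : lie_group G) (vX : vector_field X)
  (hphi : linear_flow X phi).
Local Notation Gt := (semidirect phi).
Local Notation RR := (@real_space R).
Local Notation hR := (@real_space_manifold R).
Local Notation Xt := (Xtilde phi).
Local Notation lift := (lift_field phi).

Let hM : findim_manifold G. Proof. exact: lie_manifold. Qed.
Let hMt : findim_manifold Gt. Proof. exact: (prod_manifold hM hR). Qed.
Let fEt : fin_dim (E * R^o)%type. Proof. by case: hMt. Qed.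
Let hGt : lie_group Gt. Proof. exact: (semidirect_lie_group fE hG hphi). Qed.
Let lXt : lie_algebra Xt. Proof. exact: (Xtilde_lie fE hG hphi). Qed.
Let dXt : Xt = op_lin 1 (lift X) (dtau phi). Proof. exact: Xtilde_decomp. Qed.
Let vdtau : vector_field (dtau phi). Proof. exact: (dtau_vector phi fE hG). Qed.

Lemma lift_nsmooth (Z : operator G) (f : Gt -> R) : ~ smooth_fun f
  -> lift Z f = fun=> 0.
Proof. by move=> nf; apply/funext => p; exact: on_smoothF. Qed.

Lemma lift_X_vector : vector_field (lift X).
Proof.
rewrite (_ : lift X = op_lin (-1) (dtau phi) Xt).
  by apply: (tangent_field_op_lin hMt) => //; case: lXt.
by rewrite dXt; apply/funext => f; apply/funext => p; rewrite /op_lin; ring.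
Qed.

Lemma lift_lin a (Z Z' : operator G) : lift (op_lin a Z Z') = op_lin a (lift Z)
  (lift Z').
Proof.
apply/funext => f; apply/funext => p; rewrite /op_lin.
by rewrite /lift_field /dmap /on_smooth; case: asboolP => // _;
  rewrite mulr0 addr0.
Qed.

Lemma lift0 : lift (op_zero G) = op_zero Gt.
Proof.
apply/funext => f; apply/funext => p.
by rewrite /lift_field /dmap /on_smooth; case: asboolP.
Qed.

Lemma lift_comb k (a : 'I_k -> R) (F : 'I_k -> operator G) :
  lift (ocomb a F) = ocomb a (fun i => lift (F i)).
Proof.
elim: k a F => [|k IH] a F; last by rewrite !ocomb_recl lift_lin IH.
rewrite (_ : ocomb a F = op_zero G) ?lift0.
  by apply/funext => f; apply/funext => p; rewrite /ocomb /fcomb big_ord0.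
by apply/funext => f; apply/funext => p; rewrite /ocomb /fcomb big_ord0.
Qed.

Lemma smooth_fun_fst (f : G -> R) : smooth_fun f -> smooth_fun (f \o fst : Gt
  -> R).
Proof. by move=> sf; exact: (smooth_map_comp hMt hM hR
  (smooth_map_fst hM hR) sf). Qed.

Lemma smooth_fun_snd : smooth_fun (snd : Gt -> R).
Proof. exact: (smooth_map_snd hM hR). Qed.

Lemma lift_fst (Z : operator G) f (p : Gt) : smooth_fun f ->
  lift Z (f \o fst : Gt -> R) p = Z f p.1.
Proof. by move=> sf; rewrite lift_fieldE //; exact: smooth_fun_fst. Qed.

Lemma lift_snd (Z : operator G) (p : Gt) : vector_field Z -> lift Z (snd : Gt
  -> R) p = 0.
Proof.
move=> vZ; rewrite lift_fieldE; last exact: smooth_fun_snd.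
by rewrite (tangent_field_cst hM).
Qed.

Lemma dtau_fst (f : G -> R) (p : Gt) : smooth_fun f -> dtau phi (f \o fst) p = 0.
Proof.
move=> sf; rewrite /dtau /velocity on_smoothT; last exact: smooth_fun_fst.
exact: (derive1_cst (f p.1 : R^o)).
Qed.

Lemma dtau_snd (p : Gt) : dtau phi snd p = 1.
Proof.
rewrite /dtau /velocity on_smoothT; last exact: smooth_fun_snd.
by rewrite derive1E [LHS]derive_id.
Qed.

Lemma Xtilde_fst (f : G -> R) (p : Gt) : smooth_fun f -> Xt
  (f \o fst) p = X f p.1.
Proof. by move=> sf; rewrite dXt /op_lin dtau_fst // lift_fst // mul1r addr0. Qed.

Lemma right_cosetE (p : Gt) : right_coset p = [set q : Gt | q.1 = p.1].
Proof.
case: p => g t; apply/seteqP; split=> [_ [s _ <-]|[_ s] /= ->] /=.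
  by rewrite (flow1 hG hphi) (lmul1g hG).
by exists (s - t) => //; rewrite /= (flow1 hG hphi) (lmul1g hG) subrK.
Qed.

Lemma lift_projects (Z : operator G) : vector_field Z -> projects_to (lift Z) Z.
Proof.
move=> vZ p; apply/funext => f; have [sf|nf] := pselect (smooth_fun f).
  by rewrite /dmap on_smoothT // /at_point lift_fst.
by rewrite /dmap on_smoothF // /at_point (tangent_field_nsmooth vZ nf).
Qed.

Lemma Xtilde_projects : projects_to Xt X.
Proof.
move=> p; apply/funext => f; have [sf|nf] := pselect (smooth_fun f).
  by rewrite /dmap on_smoothT // /at_point Xtilde_fst.
by rewrite /dmap on_smoothF // /at_point (tangent_field_nsmooth vX nf).
Qed.

Lemma Xtilde_snd (p : Gt) : Xt snd p = 1.
Proof. by rewrite dXt /op_lin dtau_snd lift_snd // mul1r add0r. Qed.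

Lemma lift_bracket (Z Z' : operator G) : vector_field Z -> vector_field Z' ->
  vector_field (lift Z) -> vector_field (lift Z') ->
  bracket (lift Z) (lift Z') = lift (bracket Z Z').
Proof.
move=> vZ vZ' vlZ vlZ'; apply/funext => f; have [sf|nf] := pselect
  (smooth_fun f); last first.
  by rewrite (bracket_nsmooth hMt) // lift_nsmooth.
apply/funext => p; rewrite /bracket lift_fieldE; last by case: vlZ' => _; apply.
rewrite [X in _ - X]lift_fieldE; last by case: vlZ => _; apply.
rewrite [RHS]lift_fieldE //.
by congr (Z _ _ - Z' _ _); apply/funext => g; rewrite lift_fieldE.
Qed.

(** A lift differentiates in the variable of [G] with coefficients
    independent of [tau], hence the two derivatives are mixed partial
    derivatives. *)
Lemma bracket_dtau_lift (Z : operator G) : vector_field Z -> vector_field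
  (lift Z) ->
  bracket (dtau phi) (lift Z) = op_zero Gt.
Proof.
move=> vZ vlZ; apply/funext => f; have [sf|nf] := pselect (smooth_fun f);
  last first.
  by rewrite (bracket_nsmooth hMt).
apply/funext => -[g t]; rewrite /bracket /op_zero.
have [c [v [Mc cg Zg]]] := vZ.1 g.
have ZgE k : smooth_fun k -> Z k g = 'd (k \o chart_inv c : E -> R^o)
  (chart_fun c g) v.
  by move=> sk; rewrite -[LHS]/(at_point Z g k) Zg /chart_vector on_smoothT.
pose h : E * R^o -> R^o := f \o chart_inv (prod_chart c real_chart).
have sh : smooth_at h (chart_fun c g, t).
  exact: (smooth_fun_prod_at hM t sf Mc cg).
have hc := manifold_chart hM Mc.
have -> : dtau phi (lift Z f) (g, t) =
    'd (fun y' : R^o => 'd (fun x' => h (x', y')) (chart_fun c g) v : R^o) t 1.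
  have slf : smooth_fun (lift Z f) by case: vlZ => _; exact.
  rewrite (dtauE fE hG (p := (g, t)) slf Mc cg).
  set k := (X in 'd X _ _).
  have dk : differentiable (k : E * R^o -> R^o) (chart_fun c g, t : R^o).
    exact: smooth_at_differentiable (smooth_fun_prod_at hM t slf Mc cg).
  have [_ <-] := diff_slicer (1 : R^o) dk.
  have e : (fun y' : R^o => k (chart_fun c g, y')) =
     (fun y' : R^o => 'd (fun x' => h (x', y')) (chart_fun c g) v : R^o).
    apply/funext => s; rewrite /k /= (chart_funK hc cg) lift_fieldE // ZgE //.
    exact: (smooth_slice hM s sf).
  by rewrite e.
have -> : lift Z (dtau phi f) (g, t) =
    'd (fun x' => 'd (fun y' : R^o => h (x', y')) t 1 : R^o) (chart_fun c g) v.
  have sdf : smooth_fun (dtau phi f) by case: vdtau => _; exact.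
  rewrite lift_fieldE // ZgE; last exact: (smooth_slice hM t sdf).
  have dk : differentiable (fun x => 'd h (x, t) (0, 1) : R^o) (chart_fun c g).
    have [d _] := diff_slicel v (smooth_at_differentiable (smooth_at_diff ((0,
      1) : E * R^o) sh)).
    exact: d.
  have n1 : \forall x \near chart_fun c g,
      'd h (x, t) (0, 1) = dtau phi f (chart_inv c x, t).
    apply: filterS (near_chart_invK hc cg) => x [cx ex].
    by have := dtauE fE hG (p := (chart_inv c x, t)) sf Mc cx;
      rewrite /= ex => ->.
  have n2 : \forall x \near chart_fun c g,
      'd h (x, t) (0, 1) = 'd (fun y' : R^o => h (x, y')) t 1.
    apply: filterS (smooth_at_near_slicel sh) => x shx.
    by have [_ ->] := diff_slicer (1 : R^o) (smooth_at_differentiable shx).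
  have e1 := congr1 (@^~ v) (near_eq_diffE n1 dk).
  have e2 := congr1 (@^~ v) (near_eq_diffE n2 dk).
  exact: (etrans e1 (esym e2)).
by rewrite (mixed_partials v (1 : R^o) sh) subrr.
Qed.

(** The term [dtau] of the decomposition commutes with lifts, so only the
    bracket on [G] remains. *)
Lemma Xtilde_lift_bracket (Z : operator G) : lie_algebra Z ->
  bracket Xt (lift Z) = lift (bracket X Z).
Proof.
move=> lZ; have [vZ _] := lZ; have [vlZ _] := lift_lie fE hG hphi lZ.
apply/funext => f; have [sf|nf] := pselect (smooth_fun f); last first.
  by rewrite (bracket_nsmooth hMt) // ?lift_nsmooth //; case: lXt.
apply/funext => p.
have := congr1 (fun A => A f p) (bracket_dtau_lift vZ vlZ);
  rewrite /op_zero /bracket => e.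
have := congr1 (fun A => A f p) (lift_bracket vX vZ lift_X_vector vlZ);
  rewrite {1}/bracket => <-.
rewrite /bracket dXt /op_lin (tangent_field_lin hMt) //; last 2 first.
- by case: lift_X_vector => _; apply.
- by case: vdtau => _; apply.
move/eqP: e; rewrite subr_eq0 => /eqP ->; ring.
Qed.

(** The bracket of the linear field with an invariant field is invariant
    because its lift is a bracket of invariant fields of the semi-direct
    product. *)
Lemma bracket_X_invariant (Z : operator G) : lie_algebra Z ->
  left_invariant (bracket X Z).
Proof.
move=> lZ g h; have [vZ _] := lZ; apply/funext => f.
rewrite /dmap /on_smooth; case: asboolP => sf; last first.
  by rewrite /at_point (bracket_nsmooth hM).
have lb : left_invariant (bracket Xt (lift Z)).
  apply: (bracket_invariant fEt hGt) => //; exact: (lift_lie fE hG hphi).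
rewrite (Xtilde_lift_bracket lZ) in lb.
have sff := smooth_fun_fst sf.
have e := left_invariantE ((g, 0) : Gt) ((h, 0) : Gt) lb sff.
have slf := smooth_fun_lmul fEt hGt ((g, 0) : Gt) sff.
have e1 : lift (bracket X Z) ((f \o fst) \o lmul ((g, 0) : Gt)) ((h, 0) : Gt) =
    bracket X Z (f \o lmul g) h.
  rewrite lift_fieldE //; congr (bracket X Z _ h).
  by apply/funext => k /=; rewrite (flow0 hphi).
rewrite /at_point -e1 e lift_fst //=.
by rewrite (flow0 hphi).
Qed.

(** Automorphisms fix the identity, so a linear field vanishes there. *)
Lemma X_lone f : X f (lone G) = 0.
Proof.
have := velocity_flow hphi (lone G) => /(congr1 (@^~ f)); rewrite /at_point => <-.
rewrite (_ : phi^~ (lone G) = fun=> lone G).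
  rewrite /velocity /on_smooth; case: asboolP => // _; exact: derive1_cst.
by apply/funext => t; exact: (flow1 hG hphi).
Qed.

(** At the identity, a tangent vector of the product is a multiple of the
    vector of [dtau] plus the lift of a tangent vector of [G]; both extend
    to invariant fields. *)
Lemma lie_algebra_semidirect :
  [set W | exists a Z, lie_algebra Z /\ W = op_lin a Xt (lift Z)] =
  lie_algebra (G := Gt).
Proof.
apply/seteqP; split=> [_ [a [Z [lZ ->]]]|W lW].
  by apply: (lie_algebra_lin fEt hGt) => //; exact: (lift_lie fE hG hphi).
have [c Mc ce] := manifold_cover hM (lone G).
have [[v s] eW] := tangent_chart hMt (c := prod_chart c real_chart) (lW.1.1
  (lone Gt))
  (ex_intro _ c (ex_intro _ real_chart (And3 Mc erefl erefl))) (conj ce I).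
pose D := chart_vector c (lone G) v.
have tD : tangent (lone G) D by exact: tangent_chart_vector.
have lZ := left_field_lie fE hG tD.
exists s, (left_field D); split=> //.
apply: (lie_algebra_eq_at hGt (p := lone Gt) lW).
  by apply: (lie_algebra_lin fEt hGt) => //; exact: (lift_lie fE hG hphi).
rewrite eW; apply/funext => f; have [sf|nf] := pselect (smooth_fun f); last first.
  rewrite /chart_vector on_smoothF // /at_point /op_lin lift_nsmooth //.
  by rewrite (tangent_field_nsmooth _ nf) ?mulr0 ?addr0 //; case: lXt.
rewrite /at_point /op_lin -[Xt f _]/(at_point Xt _ f) (Xtilde1 fE hG hphi).
rewrite /at_point (dtauE fE hG (p := lone Gt) sf Mc ce) lift_fieldE //.
rewrite -[left_field D _ _]/(at_point (left_field D) (lone G) _)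
  (left_field1 hG tD).
rewrite /D /chart_vector !on_smoothT //; last exact: (smooth_slice hM 0 sf).
set h := (f \o _).
have dh : differentiable (h : E * R^o -> R^o) (chart_fun c (lone G), 0 : R^o).
  exact: smooth_at_differentiable (smooth_fun_prod_at hM 0 sf Mc ce).
have [_ e] := diff_slicel v dh.
rewrite [X in _ = _ + X](_ : _ = 'd (h : E * R^o -> R^o) (chart_fun c (lone G),
  0 : R^o) (v, 0)) //.
rewrite -[s * _]/(s *: _ : R^o) -linearZ -linearD /=.
congr ('d _ _ _); apply/pair_equal_spec; split.
  by rewrite -[RHS]/(s *: 0 + v) scaler0 add0r.
by rewrite -[RHS]/(s * 1 + 0) mulr1 addr0.
Qed.

(** The coordinate [tau] has derivative 1 along the first summand and 0
    along the second. *)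
Lemma semidirect_sum_direct a (Z : operator G) : lie_algebra Z ->
  op_lin a Xt (lift Z) = op_zero Gt -> a = 0 /\ lift Z = op_zero Gt.
Proof.
move=> [vZ _] e.
have a0 : a = 0.
  have := congr1 (fun A => A snd (lone Gt)) e.
  by rewrite /op_lin Xtilde_snd lift_snd // mulr1 addr0.
split=> //; rewrite -e a0; apply/funext => f; apply/funext => p.
by rewrite /op_lin mul0r add0r.
Qed.

End SemidirectFields.

(** * The distribution of the lifted structure *)

Section AlmostRiemannian.
Context {R : realType} {n : nat} (G : lie_data 'rV[R]_n.+1) (X : operator G)
  (Y : 'I_n -> operator G) (phi : R -> G -> G).
Hypotheses (hG : lie_group G) (hARS : simple_ARS X Y phi).
Local Notation Gt := (semidirect phi).
Local Notation Xt := (Xtilde phi).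
Local Notation lift := (lift_field phi).
Local Notation Ft := (frame_tilde phi Y).

Let fE := @fin_dim_rV R n.+1.
Let hM : findim_manifold G. Proof. exact: (lie_manifold fE). Qed.
Let hMt : findim_manifold Gt. Proof. exact:
  (prod_manifold hM real_space_manifold). Qed.
Let fEt : fin_dim ('rV[R]_n.+1 * R^o)%type. Proof. by case: hMt. Qed.
Let vX : vector_field X. Proof. by case: hARS => -[]. Qed.
Let hphi : linear_flow X phi. Proof. by case: hARS => -[]. Qed.
Let lY i : lie_algebra (Y i). Proof. by case: hARS => _ + _ _; apply. Qed.
Let hGt : lie_group Gt. Proof. exact: (semidirect_lie_group fE hG hphi). Qed.
Let lXt : lie_algebra Xt. Proof. exact: (Xtilde_lie fE hG hphi). Qed.
Let rkG : rank_condition (range (frame X Y)). Proof. by case: hARS. Qed.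

Lemma frame_tilde_lie i : lie_algebra (Ft i).
Proof.
rewrite /frame_tilde; case: (unliftP ord0 i) => [j ->|->].
  by rewrite frameS; exact: (lift_lie fE hG hphi).
by rewrite frame0.
Qed.

(** The left-invariant fields that are reached by iterated brackets both on
    [G] and on the semi-direct product. *)
Let K : set (operator G) :=
  [set Z | [/\ lie_algebra Z, LA (range (frame X Y)) Z & LA (range Ft) (lift Z)]].

Let LAX : LA (range (frame X Y)) X.
Proof. by apply: LA_gen; exists ord0 => //; rewrite frame0. Qed.

Let LAXt : LA (range Ft) Xt.
Proof. by apply: LA_gen; exists ord0 => //; rewrite /frame_tilde frame0. Qed.

Let LA_tangent Z p : LA (range (frame X Y)) Z -> tangent p (at_point Z p).
Proof. by move=> hZ; rewrite -rkG; exists Z. Qed.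

Let K_lie Z : K Z -> vector_field Z. Proof. by case=> -[]. Qed.

Let K0 : K (op_zero G).
Proof.
split; first exact: (lie_algebra0 fE hG).
  by have [h _ _] := LA_subalgebra (range (frame X Y)).
by rewrite lift0; have [h _ _] := LA_subalgebra (range Ft).
Qed.

Let K_lin a Z Z' : K Z -> K Z' -> K (op_lin a Z Z').
Proof.
move=> [lZ aZ tZ] [lZ' aZ' tZ']; split; first exact: (lie_algebra_lin fE hG).
  by have [_ h _] := LA_subalgebra (range (frame X Y)); exact: h.
by rewrite lift_lin; have [_ h _] := LA_subalgebra (range Ft); exact: h.
Qed.

(** The rank condition identifies the values of the generated Lie algebra
    with the whole tangent space; in particular every generated bracket is
    tangent, which makes it a vector field. *)
Let K_bracketX Z : K Z -> K (bracket X Z).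
Proof.
move=> [lZ aZ tZ]; have [_ _ cl] := LA_subalgebra (range (frame X Y)).
have aXZ : LA (range (frame X Y)) (bracket X Z) by exact: cl.
have [vZ _] := lZ.
split=> //; last first.
  rewrite -(Xtilde_lift_bracket fE hG vX hphi lZ).
  by have [_ _ h] := LA_subalgebra (range Ft); exact: h.
split; last exact: (bracket_X_invariant fE hG vX hphi lZ).
by split=> [p|f]; [exact: LA_tangent|exact: (bracket_smooth hM)].
Qed.

Let K_bracket Z Z' : K Z -> K Z' -> K (bracket Z Z').
Proof.
move=> [lZ aZ tZ] [lZ' aZ' tZ']; have [_ _ cl] := LA_subalgebra (range
  (frame X Y)).
have aZZ : LA (range (frame X Y)) (bracket Z Z') by exact: cl.
have [vZ _] := lZ; have [vZ' _] := lZ'.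
split=> //; last first.
  rewrite -(lift_bracket fE hG vZ vZ'); last 2 first.
  - by have [] := lift_lie fE hG hphi lZ.
  - by have [] := lift_lie fE hG hphi lZ'.
  by have [_ _ h] := LA_subalgebra (range Ft); exact: h.
split; last exact: (bracket_invariant fE hG).
by split=> [p|f]; [exact: LA_tangent|exact: (bracket_smooth hM)].
Qed.

(** The fields [a X + Z] with [Z] in [K] form a Lie algebra that contains
    the frame. *)
Lemma LA_frame_decomp Z : LA (range (frame X Y)) Z ->
  exists a Z', K Z' /\ Z = op_lin a X Z'.
Proof.
move=> hZ; apply: (hZ [set W | exists a Z', K Z' /\ W = op_lin a X Z']).
  exact: (extension_subalgebra hM vX K_lie K0 K_lin K_bracket K_bracketX).
move=> _ [i _ <-]; case: (unliftP ord0 i) => [j ->|->].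
  exists 0, (Y j); rewrite frameS; split; last first.
    by apply/funext => f; apply/funext => p; rewrite /op_lin mul0r add0r.
  split=> //; apply: LA_gen; exists (fintype.lift ord0 j) => //;
    first by rewrite frameS.
  by rewrite /frame_tilde frameS.
rewrite frame0; exists 1, (op_zero G); split=> //.
by apply/funext => f; apply/funext => p; rewrite /op_lin /op_zero mul1r addr0.
Qed.

(** By the rank condition at the identity, the value of [Z] there is that of
    some generated [a X + Z'], and [X] vanishes at the identity; hence [Z]
    and [Z'] are equal, since both are invariant. *)
Lemma lie_algebra_generated Z : lie_algebra Z -> K Z.
Proof.
move=> lZ; have : tangent (lone G) (at_point Z (lone G)) by exact: lZ.1.1.
rewrite -rkG => -[W /LA_frame_decomp[a [Z' [KZ' ->]]] e].
have lZ' : lie_algebra Z' by case: KZ'.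
suff -> : Z = Z' by [].
apply: (lie_algebra_eq_at hG (p := lone G) lZ lZ'); rewrite -e.
by apply/funext => f; rewrite /at_point /op_lin (X_lone hG hphi) mulr0 add0r.
Qed.

Lemma LA_frame_tilde : LA (range Ft) =
  [set W | exists a Z, lie_algebra Z /\ W = op_lin a Xt (lift Z)].
Proof.
rewrite (lie_algebra_semidirect fE hG hphi); apply/seteqP; split=> W hW;
  last first.
  move: hW; rewrite -(lie_algebra_semidirect fE hG hphi) => -[a [Z [lZ ->]]].
  have [_ h _] := LA_subalgebra (range Ft); apply: h => //.
  by have [] := lie_algebra_generated lZ.
rewrite -(lie_algebra_semidirect fE hG hphi).
have [//||a [_ [[Z lZ <-] ->]]] := hW [set W | exists a Z,
  [set lift Z | Z in lie_algebra (G := G)] Z /\ W = op_lin a Xt Z].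
- apply: (extension_subalgebra hMt); first by case: lXt.
  + by move=> _ [Z lZ <-]; have [] := lift_lie fE hG hphi lZ.
  + by exists (op_zero G); [exact: (lie_algebra0 fE hG)|exact: lift0].
  + move=> a _ _ [Z lZ <-] [Z' lZ' <-]; rewrite -lift_lin.
    by exists (op_lin a Z Z') => //; exact: (lie_algebra_lin fE hG).
  + move=> _ _ [Z lZ <-] [Z' lZ' <-].
    exists (bracket Z Z').
      by have [] := K_bracket (lie_algebra_generated lZ)
        (lie_algebra_generated lZ').
    rewrite -(lift_bracket fE hG lZ.1 lZ'.1) //.
    * by have [] := lift_lie fE hG hphi lZ.
    * by have [] := lift_lie fE hG hphi lZ'.
  + move=> _ [Z lZ <-]; exists (bracket X Z).
      by have [] := K_bracketX (lie_algebra_generated lZ).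
    by rewrite -(Xtilde_lift_bracket fE hG vX hphi lZ).
- move=> _ [i _ <-]; rewrite /frame_tilde; case: (unliftP ord0 i) => [j ->|->].
    exists 0, (lift (Y j)); rewrite frameS; split; first by exists (Y j).
    by apply/funext => f; apply/funext => p; rewrite /op_lin mul0r add0r.
  exists 1, (op_zero Gt); rewrite frame0; split.
    by exists (op_zero G); [exact: (lie_algebra0 fE hG)|exact: lift0].
  by apply/funext => f; apply/funext => p; rewrite /op_lin /op_zero mul1r addr0.
- by exists a, Z.
Qed.

Lemma rank_condition_tilde : rank_condition (range Ft).
Proof.
by move=> p; rewrite LA_frame_tilde (lie_algebra_semidirect fE hG hphi)
  (lie_algebra_at fEt hGt).
Qed.

Lemma frame_tilde_distribution : left_invariant_distribution Ft.
Proof.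
move=> g h; have e (a : 'I_n.+1 -> R) : dmap (N := Gt) (lmul g) (fcomb a (fun i
  => at_point (Ft i) h)) =
    fcomb a (fun i => at_point (Ft i) (lmul g h)).
  have [_ iF] := lie_algebra_comb fEt hGt a frame_tilde_lie.
  exact: (iF g h).
apply/seteqP; split=> [_ [_ [a ->] <-]|_ [a ->]]; first by exists a; exact: e.
by exists (fcomb a (fun i => at_point (Ft i) h)); [exists a|exact: e].
Qed.

Lemma good_point : exists g, independent_at (frame X Y) g.
Proof. by case: hARS. Qed.

(** A relation between the fields [Y i] holds in particular at a point where
    the frame has full rank. *)
Lemma Y_independent (a : 'I_n -> R) : ocomb a Y = op_zero G -> forall i, a i = 0.
Proof.
move=> aY; have [g ind] := good_point.
pose b (i : 'I_n.+1) := if unlift ord0 i is Some j then a j else 0.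
have hb : forall f, fcomb b (fun i => at_point (frame X Y i) g) f = 0.
  move=> f; rewrite -[LHS]/(ocomb b (frame X Y) f g) ocomb_frame /op_lin.
  rewrite {1}/b unlift_none mul0r add0r.
  rewrite (_ : (fun i => b (fintype.lift ord0 i)) = a) ?aY //.
  by apply/funext => i; rewrite /b liftK.
by move=> i; have := ind b hb (fintype.lift ord0 i); rewrite /b liftK.
Qed.

Lemma ocomb_frame_tilde (a : 'I_n.+1 -> R) : ocomb a Ft =
  op_lin (a ord0) Xt (lift (ocomb (fun i => a (fintype.lift ord0 i)) Y)).
Proof. by rewrite /frame_tilde ocomb_frame lift_comb. Qed.

(** The coordinate [tau] isolates the coefficient of the first field; the
    remaining relation involves only the fields [Y i]. *)
Lemma frame_tilde_independent p : independent_at Ft p.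
Proof.
move=> a ha; pose b i := a (fintype.lift ord0 i).
have lbY := lie_algebra_comb fE hG b lY.
have e : op_lin (a ord0) Xt (lift (ocomb b Y)) = op_zero Gt.
  rewrite -ocomb_frame_tilde; apply: (lie_algebra_eq_at hGt (p := p)).
  - exact: (lie_algebra_comb fEt hGt _ frame_tilde_lie).
  - exact: (lie_algebra0 fEt hGt).
  - by apply/funext => f; exact: ha.
have [a0 l0] := semidirect_sum_direct fE hG vX hphi lbY e.
have bY0 : ocomb b Y = op_zero G.
  apply/funext => f; apply/funext => g; have [sf|nf] := pselect (smooth_fun f).
    have := lift_fst (phi := phi) fE hG (ocomb b Y) ((g, 0) : Gt) sf.
    by rewrite l0 /= => <-.
  by rewrite (tangent_field_nsmooth lbY.1 nf).
move=> i; case: (unliftP ord0 i) => [j ->|->] //; exact: Y_independent bY0 j.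
Qed.

(** The tangent space is the image of the coordinate space of dimension
    [n.+1], so as many independent vectors span it; the matrix of their
    coordinates is invertible. *)
Lemma frame_spans g D : independent_at (frame X Y) g -> tangent g D ->
  span_at (frame X Y) g D.
Proof.
move=> ind tD; have [c Mc cg] := manifold_cover hM g.
have tF i : tangent g (at_point (frame X Y i) g).
  case: (unliftP ord0 i) => [j ->|->]; first by rewrite frameS; exact: (lY j).1.1.
  by rewrite frame0; exact: vX.1.
have /choice[w wE] : forall i, exists w, at_point
  (frame X Y i) g = chart_vector c g w.
  by move=> i; exact: (tangent_chart hM (tF i)).
pose A : 'M[R]_n.+1 := \matrix_i w i.
have comb (x : 'rV[R]_n.+1) : chart_vector c g (x *m A) =
    fcomb (x ord0) (fun i => at_point (frame X Y i) g).
  apply/funext => f; rewrite /fcomb.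
  under eq_bigr do rewrite wE.
  have -> : x *m A = \sum_i x ord0 i *: w i.
    by rewrite mulmx_sum_row; apply: eq_bigr => i _; rewrite rowK.
  rewrite /chart_vector /on_smooth; case: asboolP => _;
    last by rewrite big1 // => i _; rewrite mulr0.
  by rewrite linear_sum; apply: eq_bigr => i _; rewrite linearZ.
have Afree : row_free A.
  rewrite -kermx_eq0; apply/eqP/row_matrixP => i; rewrite row0.
  have e := comb (row i (kermx A)); rewrite -row_mul mulmx_ker row0 in e.
  apply/rowP => j; rewrite [RHS]mxE; apply: ind => f.
  rewrite -[LHS]/((fcomb _ _) f) -e /chart_vector /on_smooth;
    case: asboolP => // _.
  by rewrite linear0.
have [v ->] := tangent_chart hM tD Mc cg.
exists ((v *m invmx A) ord0); rewrite -comb mulmxKV //.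
by rewrite -row_free_unit.
Qed.

(** Where the frame of [G] has full rank, the lift of the linear field is a
    complement of the distribution. Its value there extends to an invariant
    field [W], and the relations between invariant fields hold at all points
    once they hold at one. *)
Lemma frame_tilde_codim1 p : codim1_at Ft p.
Proof.
have [g ind] := good_point; pose q : Gt := (g, 0).
have lF (a : 'I_n.+1 -> R) : lie_algebra (ocomb a Ft).
  exact: (lie_algebra_comb fEt hGt _ frame_tilde_lie).
split=> [_ [a ->]|]; first exact: (lF a).1.1.
have [W lW eW] : [set at_point Z q | Z in lie_algebra (G := Gt)] (at_point
  (lift X) q).
  rewrite (lie_algebra_at fEt hGt); exact: (lift_X_vector fE hG hphi).1.
exists (at_point W p); split; first exact: lW.1.1.
  move=> [a ea]; have {}ea : W = ocomb a Ft by exact: (lie_algebra_eq_at hGt (p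
    := p)).
  rewrite {lW}ea ocomb_frame_tilde in eW.
  have a0 : a ord0 = 0.
    have := congr1 (@^~ (snd : Gt -> R)) eW; rewrite /at_point /op_lin.
    rewrite (Xtilde_snd fE hG vX hphi) !(lift_snd (phi := phi) fE hG) //;
      last first.
      exact: (lie_algebra_comb fE hG _ lY).1.
    by rewrite mulr1 addr0.
  pose b (i : 'I_n.+1) := if unlift ord0 i is Some j then a
    (fintype.lift ord0 j) else -1.
  suff hb : forall f, fcomb b (fun i => at_point (frame X Y i) g) f = 0.
    by have /eqP := ind b hb ord0; rewrite /b unlift_none oppr_eq0 oner_eq0.
  move=> f.
  rewrite -[LHS]/(ocomb b (frame X Y) f g) ocomb_frame /op_lin.
  rewrite {1}/b unlift_none.
  rewrite (_ : (fun i => b (fintype.lift ord0 i)) = (fun i => a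
    (fintype.lift ord0 i))); last first.
    by apply/funext => i; rewrite /b liftK.
  have [sf|nf] := pselect (smooth_fun f); last first.
    rewrite (tangent_field_nsmooth vX nf)
      (tangent_field_nsmooth _ nf) ?mulr0 ?addr0 //.
    exact: (lie_algebra_comb fE hG _ lY).1.
  have := congr1 (@^~ (f \o fst : Gt -> R)) eW;
    rewrite /at_point /op_lin a0 mul0r add0r.
  rewrite !(lift_fst (phi := phi) fE hG) //= => ->.
  by rewrite mulN1r addNr.
move=> D tD; have [V lV <-] : [set at_point Z p | Z in lie_algebra (G := Gt)] D.
  by rewrite (lie_algebra_at fEt hGt).
have [s [Z [lZ eV]]] : [set W | exists a Z, lie_algebra Z /\ W = op_lin a Xt
  (lift Z)] V.
  by rewrite (lie_algebra_semidirect fE hG hphi).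
have [x ex] := frame_spans ind (lZ.1.1 g).
exists (x ord0), (fun i : 'I_n.+1 => if unlift ord0 i is Some j then x
  (fintype.lift ord0 j) else s).
set b := (X in fcomb X _).
suff e : V = op_lin (x ord0) W (ocomb b Ft).
  apply/funext => f; have := congr1 (fun A => A f p) e;
    rewrite /op_lin /at_point => ->.
  by rewrite addrC addKr.
apply: (lie_algebra_eq_at hGt (p := q) lV); first exact:
  (lie_algebra_lin fEt hGt).
have e1 : at_point (op_lin (x ord0) W (ocomb b Ft)) q = fun f
  => x ord0 * lift X f q + ocomb b Ft f q.
  by apply/funext => f; rewrite /op_lin /at_point -[lift X f q]/(at_point
    (lift X) q f) -eW.
rewrite e1; apply/funext => f; rewrite eV /at_point ocomb_frame_tilde /op_lin.
rewrite {1}/b unlift_none.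
rewrite (_ : (fun i => b (fintype.lift ord0 i)) = (fun i => x
  (fintype.lift ord0 i))); last first.
  by apply/funext => i; rewrite /b liftK.
have -> : lift Z f q = lift (ocomb x (frame X Y)) f q.
  have [sf|nf] := pselect (smooth_fun f); last by rewrite !lift_nsmooth.
  by rewrite !lift_fieldE //= -[LHS]/(at_point Z g _) ex.
rewrite ocomb_frame lift_lin /op_lin; ring.
Qed.

End AlmostRiemannian.

(** * Integrals, absolutely continuous functions and lengths *)

Section Integration.
Context {R : realType}.
Local Notation mu := (@lebesgue_measure R).

Section LowerIntegral.
Local Open Scope ereal_scope.
Context d (T : measurableType d) (m : {measure set T -> \bar R}).

(** The integral of a nonnegative function is a supremum over the simple
    functions below it, hence it is monotone on arbitrary functions. The
    almost-Riemannian norm of a velocity, a fibrewise infimum, is integrated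
    in this sense. *)
Lemma le_integral_lower (D : set T) (f g : T -> \bar R) :
  (forall x, D x -> 0 <= f x) -> (forall x, D x -> f x <= g x) ->
  \int[m]_(x in D) f x <= \int[m]_(x in D) g x.
Proof.
move=> f0 fg; rewrite !ge0_integralE //; last first.
  by move=> x Dx; exact: le_trans (f0 x Dx) (fg x Dx).
apply: ereal_sup_le => _ [h hf <-]; exists h => // x.
apply: le_trans (hf x) _; rewrite !patchE; case: ifPn => // /[1!inE].
exact: fg.
Qed.

(** Raising [g] to infinity on the exceptional null set makes the inequality
    hold everywhere without changing the integral of [g]. *)
Lemma ae_le_integral_upper (D : set T) (f g : T -> \bar R) : measurable D ->
  (forall x, D x -> 0 <= f x) -> (forall x, D x -> 0 <= g x) ->
  measurable_fun D g -> {ae m, forall x, D x -> f x <= g x} ->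
  \int[m]_(x in D) f x <= \int[m]_(x in D) g x.
Proof.
move=> mD f0 g0 mg [N [mN N0 fgN]].
pose k : T -> \bar R := (cst +oo) \_ N.
have mk : measurable_fun D k.
  apply: (measurable_funS measurableT) => //.
  by apply/(measurable_restrictT _ _).1 => //; exact: measurable_cst.
rewrite [leRHS](_ : _ = \int[m]_(x in D) maxe (g x) (k x)).
  apply: le_integral_lower => // x Dx; rewrite le_max /k patchE.
  have [xN|xN] := boolP (x \in N); first by rewrite leey orbT.
  apply/orP; left; apply: contrapT => h; move/negP: xN; apply; rewrite inE.
  by apply: fgN => /= /(_ Dx).
apply: ge0_ae_eq_integral => //.
- exact: measurable_maxe.
- by move=> x Dx; rewrite le_max g0.
- exists N; split=> // x /= h; apply: contrapT => xN; apply: h => Dx.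
  by rewrite /k patchE memNset // max_l // g0.
Qed.

(** Dual to the previous lemma: [f] is put to 0 on the exceptional set. *)
Lemma ae_le_integral_lower (D : set T) (f g : T -> \bar R) : measurable D ->
  (forall x, D x -> 0 <= f x) -> (forall x, D x -> 0 <= g x) ->
  measurable_fun D f -> {ae m, forall x, D x -> f x <= g x} ->
  \int[m]_(x in D) f x <= \int[m]_(x in D) g x.
Proof.
move=> mD f0 g0 mf [N [mN N0 fgN]].
have mf' : measurable_fun D (f \_ (~` N)).
  apply/(measurable_restrict _ _ _).1 => //; first exact: measurableC.
  by apply: measurable_funS mf => //; exact: subIsetl.
rewrite [leLHS](_ : _ = \int[m]_(x in D) (f \_ (~` N)) x).
  apply: le_integral_lower => x Dx; rewrite patchE; case: ifPn => // xN;
    try exact: f0; try exact: g0.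
  apply: contrapT => h; move: xN; rewrite inE /=; apply.
  by apply: fgN => /= /(_ Dx).
apply: ge0_ae_eq_integral => //.
- by move=> x Dx; rewrite patchE; case: ifPn => // _; exact: f0.
- exists N; split=> // x /= h; apply: contrapT => xN; apply: h => Dx.
  by rewrite patchE mem_set.
Qed.
End LowerIntegral.

Lemma abs_contS (E : normedModType R) a b (f : R -> E) (c : E) :
  abs_cont a b f -> abs_cont a b (fun t => c + f t).
Proof.
move=> h e e0; have [d d0 hd] := h e e0; exists d => // k I I1 I2 I3.
by under eq_bigr do rewrite opprD addrACA subrr add0r; exact: hd.
Qed.

Lemma abs_cont_pair (E F : normedModType R) a b (f : R -> E) (g : R -> F) :
  abs_cont a b f -> abs_cont a b g -> abs_cont a b (fun t => (f t, g t)).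
Proof.
move=> hf hg e e0; have e20 : 0 < e / 2 by rewrite divr_gt0.
have [d1 d10 h1] := hf _ e20; have [d2 d20 h2] := hg _ e20.
exists (Num.min d1 d2); first by rewrite lt_min d10.
move=> k I I1 I2; rewrite lt_min => /andP[I3 I4].
rewrite [ltRHS]splitr; apply: le_lt_trans (ltrD (h1 _ _ I1 I2 I3)
  (h2 _ _ I1 I2 I4)).
rewrite -big_split /=; apply: ler_sum => i _.
by rewrite prod_normE /= ge_max lerDl lerDr !normr_ge0.
Qed.

Lemma abs_cont_fst (E F : normedModType R) a b (f : R -> E * F) :
  abs_cont a b f -> abs_cont a b (fun t => (f t).1).
Proof.
move=> h e e0; have [d d0 hd] := h e e0; exists d => // k I I1 I2 I3.
apply: le_lt_trans (hd k I I1 I2 I3); apply: ler_sum => i _.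
by rewrite prod_normE le_max lexx.
Qed.

Section Primitive.
Variables (w : R -> R) (iw : mu.-integrable setT (EFin \o w)).

Let primitive (t : R) : R := \int[mu]_(s in `[0, t]) w s.

Lemma integrable_sub (A : set R) : measurable A -> mu.-integrable A (EFin \o w).
Proof. by move=> mA; apply: integrableS iw. Qed.

Lemma primitive_sub a b : 0 <= a -> a <= b ->
  primitive b - primitive a = \int[mu]_(s in `]a, b]) w s.
Proof.
move=> a0 ab; rewrite /primitive Rintegral_itvB //.
exact: integrable_sub.
Qed.

(** The sum of the increments over non-overlapping intervals is at most the
    integral of [`|w|] over their union, which is small with the measure of
    the union. Half-open intervals make the union disjoint. *)
Lemma abs_cont_primitive a b : 0 <= a -> abs_cont a b (primitive : R -> R^o).
Proof.
move=> a0 e e0; have [d [d0 hd]] := integral_normr_continuous iw e0.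
exists d => // k I I1 I2 I3.
pose J i : set R := `](I i).1, (I i).2]%classic.
have mJ i : measurable (J i) by exact: measurable_itv.
have tJ : trivIset setT J.
  move=> i j _ _ [x [/= ]]; rewrite /J /= !in_itv /= => /andP[x1 x2] /andP[x3 x4].
  apply: contrapT => /eqP /I2 /orP[h|h].
    by have := lt_le_trans x3 (le_trans x2 h); rewrite ltxx.
  by have := lt_le_trans x1 (le_trans x4 h); rewrite ltxx.
pose A := \big[setU/set0]_(i < k) J i.
have mA : measurable A by exact: bigsetU_measurable.
have muA : (mu A < d%:E)%E.
  rewrite /A measure_semi_additive_ord //.
  rewrite (eq_bigr (fun i => ((I i).2 - (I i).1)%:E)) ?sumEFin ?lte_fin // => i _.
  rewrite /= lebesgue_measure_itv /= lte_fin; have /and3P[_ + _] := I1 i.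
  by rewrite le_eqVlt => /orP[/eqP->|->//]; rewrite ltxx subrr.
apply: le_lt_trans (hd A mA muA).
rewrite -lee_fin -sumEFin /Rintegral fineK; last first.
  by apply: integrable_fin_num => //; exact: (integrable_abse
    (integrable_sub mA)).
rewrite /A ge0_integral_bigsetU //=; last 3 first.
- exact: index_enum_uniq.
- by apply: sub_trivIset tJ.
- have /integrableP[mw _] := integrable_abse (integrable_sub mA).
  exact: mw.
apply: lee_sum => i _; have /and3P[h1 h2 h3] := I1 i.
rewrite primitive_sub //; last exact: le_trans a0 h1.
rewrite -abse_EFin /Rintegral fineK; last first.
  by apply: integrable_fin_num => //; exact: integrable_sub.
apply: le_abse_integral => //.
by have /integrableP[mw _] := integrable_sub (mJ i).
Qed.

Lemma continuous_primitive T : 0 <= T -> {within `[0, T], continuous primitive}.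
Proof.
move=> T0; apply: parameterized_integral_continuous => //; exact: integrable_sub.
Qed.

Lemma derive_primitive : {ae mu, forall t, 0 < t ->
  derivable (primitive : R^o -> R^o) t 1 /\ derive1 (primitive : R^o
    -> R^o) t = w t}.
Proof.
have lw : locally_integrable setT w.
  by have := integrable_locally measurableT iw; rewrite patch_setT.
have := @FTC1 R w (BLeft 0) (fun y => integrable_sub (measurable_itv _)) lw.
apply: filterS; first exact: (ae_filter_ringOfSetsType mu).
by move=> t h t0; apply: h; rewrite /= lte_fin.
Qed.
End Primitive.

Lemma interior_continuous (M : topologicalType) (T t : R) (gamma : R -> M) :
  {within `[0, T], continuous gamma} -> 0 < t < T -> {for t, continuous gamma}.
Proof.
move=> cg tT.
have cg' : {within `]0, T[, continuous gamma}.
  by apply: continuous_subspaceW cg; exact: subset_itv_oo_cc.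
rewrite continuous_open_subspace in cg'; last exact: interval_open.
by apply: cg'; rewrite inE /= in_itv.
Qed.

Lemma ae_interior T : {ae mu, forall t : R, `[0, T]%classic t -> 0 < t < T}.
Proof.
exists ([set 0] `|` [set T]); split.
- by apply: measurableU; exact: measurable_set1.
- apply: null_set_setU; try exact: measurable_set1.
    exact: lebesgue_measure_set1.
  exact: lebesgue_measure_set1.
move=> t /= /not_implyP[]; rewrite in_itv /= => /andP[t0 tT] /negP.
rewrite negb_and -!leNgt => /orP[h|h]; [left|right]; apply/eqP; rewrite eq_le.
  by rewrite h t0.
by rewrite h tT.
Qed.

Lemma enorm_ge0 k (a : 'I_k -> R) : 0 <= enorm a.
Proof. exact: sqrtr_ge0. Qed.

Lemma measurable_enorm k (D : set R) (u : R -> 'I_k -> R) : measurable D ->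
  (forall i, mu.-integrable D (fun t => (u t i)%:E)) ->
  measurable_fun D (fun t => (enorm (u t))%:E).
Proof.
move=> mD iu; apply/measurable_EFinP; apply: measurableT_comp.
  by apply: continuous_measurable_fun; exact: sqrt_continuous.
apply: measurable_sum => i; apply: measurable_funX.
by have /integrableP[/measurable_EFinP] := iu i.
Qed.

Section ARnorm.
Context {E : normedModType R} (M : smooth_space E) (k : nat) (F : 'I_k
  -> operator M).

Lemma ARnorm_ge0 p D : 0 <= ARnorm F p D.
Proof.
rewrite /ARnorm; set S := (X in inf X).
have [[x Sx]|S0] := pselect (S !=set0).
  apply: lb_le_inf; first by exists x.
  by move=> _ [a _ <-]; exact: enorm_ge0.
by rewrite (_ : S = set0) ?inf0 //; apply/eqP/negP => /negP/set0P.
Qed.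

Lemma ARnorm_le p a : ARnorm F p (fcomb a (fun i => at_point (F i) p)) <= enorm a.
Proof.
apply: ge_inf; first by exists 0 => _ [b _ <-]; exact: enorm_ge0.
by exists a.
Qed.
End ARnorm.

End Integration.

(** * Lifting and projecting trajectories *)

Lemma derive1_cstD {R : realType} (c : R) (f : R^o -> R^o) t :
  derivable f t 1 ->
  derivable (fun s => c + f s : R^o) t 1 /\
  derive1 (fun s => c + f s : R^o) t = derive1 f t.
Proof.
move=> df; have dc : derivable (cst c : R^o -> R^o) t 1 by exact: derivable_cst.
split; first exact: derivableD dc df.
by rewrite !derive1E; have := deriveD dc df; rewrite derive_cst add0r; exact.
Qed.

Section Trajectories.
Context {R : realType} {n : nat} (G : lie_data 'rV[R]_n.+1) (X : operator G)
  (Y : 'I_n -> operator G) (phi : R -> G -> G).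
Hypotheses (hG : lie_group G) (hARS : simple_ARS X Y phi).
Local Notation Gt := (semidirect phi).
Local Notation Xt := (Xtilde phi).
Local Notation lift := (lift_field phi).
Local Notation Ft := (frame_tilde phi Y).
Local Notation mu := (@lebesgue_measure R).

Let fE := @fin_dim_rV R n.+1.
Let ae_filter := ae_filter_ringOfSetsType mu.
Existing Instance ae_filter.
Let hM : findim_manifold G. Proof. exact: (lie_manifold fE). Qed.
Let hMt : findim_manifold Gt. Proof. exact:
  (prod_manifold hM real_space_manifold). Qed.
Let vX : vector_field X. Proof. by case: hARS => -[]. Qed.
Let hphi : linear_flow X phi. Proof. by case: hARS => -[]. Qed.
Let lY i : lie_algebra (Y i). Proof. by case: hARS => _ + _ _; apply. Qed.

Let vframe i : vector_field (frame X Y i).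
Proof.
by case: (unliftP ord0 i) => [j ->|->]; rewrite ?frameS ?frame0 //; case: (lY j).
Qed.

(** Along a trajectory this is the relation between the two control systems:
    the lifted one adds the equation that the derivative of [tau] is the
    first control. *)
Lemma ocomb_tildeE (a : 'I_n.+1 -> R) f (p : Gt) : smooth_fun f ->
  ocomb a Ft f p =
  ocomb a (frame X Y) (fun g => f (g, p.2)) p.1 + a ord0 * dtau phi f p.
Proof.
move=> sf; rewrite ocomb_frame_tilde ocomb_frame /op_lin
  (Xtilde_decomp fE hG hphi) /op_lin.
by rewrite !lift_fieldE //; ring.
Qed.

Lemma ocomb_tilde_fst (a : 'I_n.+1 -> R) f (p : Gt) : smooth_fun f ->
  ocomb a Ft (f \o fst) p = ocomb a (frame X Y) f p.1.
Proof.
move=> sf; have sff := smooth_fun_fst phi fE hG sf.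
by rewrite ocomb_tildeE // (dtau_fst fE hG) // mulr0 addr0.
Qed.

Lemma ocomb_nsmooth (a : 'I_n.+1 -> R) f g : ~ smooth_fun f ->
  ocomb a (frame X Y) f g = 0.
Proof.
move=> nf; rewrite /ocomb /fcomb big1 // => i _.
by rewrite /at_point (tangent_field_nsmooth (vframe i) nf) mulr0.
Qed.

(** The second component is the primitive of the first control, cut off
    outside [`[0, T]] so as to be integrable on the line; almost everywhere
    it is differentiable with the right derivative. *)
Lemma trajectory_lift (T : R) (u : R -> 'I_n.+1 -> R) (gamma : R -> G) (tau0
  : R) :
  0 <= T -> trajectory (frame X Y) T u gamma ->
  trajectory Ft T u (fun t => (gamma t,
    tau0 + \int[mu]_(s in `[0, t]) ((fun s => u s ord0) \_ `[0, T]) s) : Gt).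
Proof.
move=> T0 [iu [cg ag] dg].
set w := (fun s => u s ord0) \_ `[0, T].
have iw : mu.-integrable setT (EFin \o w).
  by rewrite /w -restrict_EFin; apply/integrable_restrict => //=; rewrite setTI;
    exact: iu.
pose tau t := tau0 + \int[mu]_(s in `[0, t]) w s.
rewrite -[trajectory _ _ _ _]/(trajectory Ft T u (fun t => (gamma t,
  tau t) : Gt)).
split=> //; first split.
- have ct : {within `[0, T], continuous tau}.
    move=> t; apply: (@continuousD _ _ (subspace `[0, T])); first exact: cvg_cst.
    exact: (continuous_primitive iw T0).
  by move=> t; exact: (cvg_pair (cg t) (ct t)).
- move=> _ a b [c [d [Mc -> ->]]] a0 ab bT img.
  apply: abs_cont_pair.
    by apply: ag => // _ [t tab <-]; have [] := img (gamma t,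
      tau t) (ex_intro2 _ _ t tab erefl).
  by apply: abs_contS; exact: abs_cont_primitive.
apply: filterS3 dg (ae_interior T) (derive_primitive iw) => t h1 h2 h3 tT.
have [/= dgam vgam] := h1 tT; have /= tT' := h2 tT.
have [t0 tT2] := andP tT'; have [dw ew] := h3 t0.
have cgt := interior_continuous cg tT'.
have [dtau' etau'] := derive1_cstD tau0 dw.
have etau : derive1 (tau : R^o -> R^o) t = u t ord0.
  by rewrite [LHS]etau' ew /w patchE mem_set.
split.
  have [c [Mc cp dc]] := dgam; exists (prod_chart c real_chart); split=> //.
    by exists c, real_chart.
  apply/derivable1_diffP; apply: differentiable_pair.
    exact/derivable1_diffP.
  exact/derivable1_diffP.
apply/funext => f; have [sf|nf] := pselect (smooth_fun f); last first.
  rewrite /velocity on_smoothF // /fcomb big1 // => i _.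
  have [vF _] := frame_tilde_lie hG hARS i.
  by rewrite /at_point (tangent_field_nsmooth vF nf) mulr0.
rewrite (velocity_pair hM cgt dgam dtau' sf) etau vgam.
by rewrite -[RHS]/(ocomb (u t) Ft f (gamma t, tau t)) ocomb_tildeE.
Qed.

Lemma trajectory_proj (T : R) (u : R -> 'I_n.+1 -> R) (gamma : R -> Gt) :
  trajectory Ft T u gamma -> trajectory (frame X Y) T u (fun t => (gamma t).1).
Proof.
move=> [iu [cg ag] dg]; split=> //; first split.
- move=> t; apply: (@continuous_comp (subspace `[0, T]) Gt G gamma fst);
  first exact: cg.
  exact: cvg_fst.
- move=> c a b Mc a0 ab bT img.
  apply: (@abs_cont_fst R _ _ a b (chart_fun (prod_chart c real_chart) \o gamma)).
  apply: ag => //; first by exists c, real_chart.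
  by move=> _ [t tab <-]; split=> //; apply: img; exists t.
apply: filterS dg => t h tT; have [[_ [[c [d [Mc -> ->]]] [cp _] dc]] vg] := h tT.
split.
  exists c; split=> //; apply/derivable1_diffP.
  apply: (@differentiable_comp _ _ _ _ (chart_fun
    (prod_chart c real_chart) \o gamma) fst).
    exact/derivable1_diffP.
  by apply: linear_differentiable => ?; exact: cvg_fst.
apply/funext => f; have [sf|nf] := pselect (smooth_fun f); last first.
  by rewrite /velocity on_smoothF // -[RHS]/(ocomb (u t) (frame X Y) f
    (gamma t).1) ocomb_nsmooth.
have := congr1 (@^~ (f \o fst)) vg.
rewrite -[X in _ = X]/(ocomb (u t) Ft (f \o fst) (gamma t)) ocomb_tilde_fst //.
rewrite /velocity !on_smoothT //; exact: (smooth_fun_fst phi fE hG sf).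
Qed.

Lemma SRlength_le_ARlength (T : R) u gamma : trajectory (frame X Y) T u gamma ->
  {ae mu, forall t, `[0, T]%classic t ->
    enorm (u t) = ARnorm (frame X Y) (gamma t) (velocity gamma t)} ->
  (SRlength T u <= ARlength (frame X Y) T gamma)%E.
Proof.
move=> [iu _ _] e; apply: ae_le_integral_lower => //.
- by move=> t _; rewrite lee_fin enorm_ge0.
- by move=> t _; rewrite lee_fin ARnorm_ge0.
- exact: measurable_enorm.
- by apply: filterS e => t h tT; rewrite lee_fin h.
Qed.

Lemma ARlength_le_SRlength (T : R) u gamma : trajectory (frame X Y) T u gamma ->
  (ARlength (frame X Y) T gamma <= SRlength T u)%E.
Proof.
move=> [iu _ dg]; apply: ae_le_integral_upper => //.
- by move=> t _; rewrite lee_fin ARnorm_ge0.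
- by move=> t _; rewrite lee_fin enorm_ge0.
- exact: measurable_enorm.
- by apply: filterS dg => t h tT; rewrite lee_fin; have [_ ->] := h tT;
  exact: ARnorm_le.
Qed.

(** A competitor upstairs projects to a competitor downstairs whose
    almost-Riemannian length is at most the length of its control, and for
    the minimal control the two lengths agree. *)
Lemma AR_minimal_lift (T : R) (u : R -> 'I_n.+1 -> R) (g0 g1 : G) (tau0 tau1
  : R) :
  AR_minimal (frame X Y) T u g0 g1 ->
  tau1 - tau0 = \int[mu]_(t in `[0, T]) u t ord0 ->
  (exists gamma, steers Ft T u gamma (g0, tau0) (g1, tau1)) /\
  SR_minimal Ft T u (g0, tau0) (g1, tau1).
Proof.
move=> [gamma [[T0 tg gam0 gam1] gmin genorm]] etau.
suff ex : exists gamma, steers Ft T u gamma (g0, tau0) (g1, tau1).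
  split=> //; split=> // T' u' gamma' [T'0 tg' g'0 g'1].
  have tp := trajectory_proj tg'.
  apply: le_trans (SRlength_le_ARlength tg genorm) _.
  apply: le_trans (ARlength_le_SRlength tp); apply: (gmin T' u').
  by split => //=; rewrite ?g'0 ?g'1.
exists (fun t => (gamma t, tau0 + \int[mu]_(s in `[0,
  t]) ((fun s => u s ord0) \_ `[0, T]) s)).
split=> //; first exact: trajectory_lift.
  by rewrite gam0 set_itv1 Rintegral_set1 addr0.
rewrite gam1; congr (_, _); rewrite -(subrK tau0 tau1) etau addrC; congr (_ + _).
by apply: eq_Rintegral => t tT; rewrite patchE tT.
Qed.

End Trajectories.

Theorem mainTheorem6 (R : realType) (n : nat) (G : lie_data 'rV[R]_n.+1)
    (X : operator G) (Y : 'I_n -> operator G) (phi : R -> G -> G)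
    (hG : lie_group G) (hconn : connected [set: G])
    (hARS : simple_ARS X Y phi) :
  let Gt := semidirect phi in
  let Xt : operator Gt := Xtilde phi in
  let Ft : 'I_n.+1 -> operator Gt := frame_tilde phi Y in
  (* (1) *)
  ([/\ lie_group Gt,
       lie_algebra Xt,
       at_point Xt (lone Gt) = at_point (dtau phi) (lone Gt),
       Xt = op_lin 1 (lift_field phi X) (dtau phi) &
       forall Z, lie_algebra Z -> lie_algebra (lift_field phi Z)] /\
   [/\ left_invariant_distribution Ft,
       forall p, codim1_at Ft p &
       rank_condition (range Ft)] /\
   [/\ LA (range Ft) =
         [set W | exists a Z, lie_algebra Z /\ W = op_lin a Xt (lift_field phi Z)],
       [set W | exists a Z, lie_algebra Z /\ W = op_lin a Xt (lift_field phi Z)] =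
         lie_algebra (G := Gt) &
       forall a Z, lie_algebra Z -> op_lin a Xt (lift_field phi Z) = op_zero Gt ->
         a = 0 /\ lift_field phi Z = op_zero Gt] /\
   subriemannian Ft /\ (forall i, left_invariant (Ft i))) /\
  (* (2) *)
  [/\ forall p : Gt, right_coset p = [set q : Gt | q.1 = p.1],
      projects_to Xt X &
      forall i, projects_to (lift_field phi (Y i)) (Y i)] /\
  (* (3) *)
  (forall (T : R) (u : R -> 'I_n.+1 -> R) (g0 g1 : G),
    AR_minimal (frame X Y) T u g0 g1 ->
    forall tau0 tau1 : R,
      tau1 - tau0 = \int[@lebesgue_measure R]_(t in `[0, T]) u t ord0 ->
      (exists gamma, steers Ft T u gamma (g0, tau0) (g1, tau1)) /\
      SR_minimal Ft T u (g0, tau0) (g1, tau1)).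
Proof.
move=> Gt Xt Ft.
have fE := @fin_dim_rV R n.+1.
have [[vX hphi] lY _ _] := hARS.
have lF := frame_tilde_lie hG hARS.
split; last split.
- split; last split; last split; last split.
  + split.
    * exact: (semidirect_lie_group fE hG hphi).
    * exact: (Xtilde_lie fE hG hphi).
    * exact: (Xtilde1 fE hG hphi).
    * exact: (Xtilde_decomp fE hG hphi).
    * by move=> Z; exact: (lift_lie fE hG hphi).
  + split; first exact: (frame_tilde_distribution hG hARS).
      exact: (frame_tilde_codim1 hG hARS).
    exact: (rank_condition_tilde hG hARS).
  + split; first exact: (LA_frame_tilde hG hARS).
      exact: (lie_algebra_semidirect fE hG hphi).
    by move=> a Z; exact: (semidirect_sum_direct fE hG vX hphi).
  + split; last exact: (rank_condition_tilde hG hARS).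
      by move=> i; have [] := lF i.
    exact: (frame_tilde_independent hG hARS).
  + by move=> i; have [] := lF i.
- split.
  + exact: (right_cosetE hG hphi).
  + exact: (Xtilde_projects fE hG vX hphi).
  + move=> i; exact: (lift_projects fE hG (lY i).1).
- by move=> T u g0 g1 hmin tau0 tau1; exact: (AR_minimal_lift hG hARS hmin).
Qed.
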